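(* Let $\Gamma$ be a group. There is an equivalence $$H\mathcal{X}^\Gamma(\Gamma_{can,min}\otimes S_{min,max})\simeq H(\Gamma,\mathbb{Z}[S]),$$ natural in the $\Gamma$-set $S$, i.e. an equivalence between the two functors $\Gamma\mathbf{Set}\to\mathbf{Sp}$ given by $S\mapsto H\mathcal{X}^\Gamma(\Gamma_{can,min}\otimes S_{min,max})$ and $S\mapsto H(\Gamma,\mathbb{Z}[S])$.
   Context: Let $\Gamma$ be a group. A bornology on a set $X$ is a set of subsets of $X$ (the bounded subsets) that is closed under subsets and finite unions and covers $X$. A coarse structure on $X$ is a set $\mathcal{C}$ of subsets of $X\times X$ (the entourages) that contains the diagonal and is closed under subsets, finite unions, inverses and compositions. They are compatible if $U[B]=\{x\mid \exists b\in B:(x,b)\in U\}$ is bounded for every entourage $U$ and bounded $B$. A $\Gamma$-bornological coarse space is a $\Gamma$-set with a coarse structure and a compatible bornology, both preserved by $\Gamma$, such that the $\Gamma$-invariant entourages are cofinal in $\mathcal{C}$. Morphisms are equivariant maps that are controlled (send entourages to entourages) and proper (preimages of bounded sets are bounded). $\Gamma_{can,min}$ is $\Gamma$ with left multiplication action, bounded sets the finite subsets, and coarse structure generated by the sets $\Gamma(B\times B)=\{(\gamma b,\gamma b')\mid\gamma\in\Gamma,\ b,b'\in B\}$ for finite $B\subseteq\Gamma$. $S_{min,max}$ is the $\Gamma$-set $S$ with the coarse structure generated by the diagonal and with all subsets bounded. $X\otimes X'$ is $X\times X'$ (diagonal action) with the coarse structure generated by products $U\times U'$ of entourages and the bornology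 generated by products $B\times B'$ of bounded sets. Equivariant coarse ordinary homology. An $n$-chain on $X$ is a function $c\colon X^{n+1}\to\mathbb{Z}$ with support $\mathrm{supp}(c)=\{c\neq0\}$. It is controlled if there is an entourage $U$ with $(x_i,x_j)\in U$ for all $i,j$ and all $(x_0,\dots,x_n)\in\mathrm{supp}(c)$; it is locally finite if for every bounded $B$ only finitely many points of $\mathrm{supp}(c)$ have some coordinate in $B$. $C\mathcal{X}^\Gamma_n(X)$ is the abelian group of controlled, locally finite, $\Gamma$-invariant $n$-chains; with $\partial=\sum_{i=0}^n(-1)^i\partial_i$ ($\partial_i$ the linear extension of omitting the $i$-th entry) it forms a chain complex $C\mathcal{X}^\Gamma(X)$, functorial by push-forward. $H\mathcal{X}^\Gamma:=\mathcal{E}\mathcal{M}\circ C\mathcal{X}^\Gamma$, where $\mathcal{E}\mathcal{M}\colon\mathbf{Ch}\to\mathbf{Ch}[W^{-1}]\to\mathbf{Sp}$ is the Eilenberg–MacLane functor (localize at quasi-isomorphisms, then apply $\mathrm{map}(\mathbb{Z}[0],-)$). Group homology. For a $\mathbb{Z}[\Gamma]$-module $V$, $H(\Gamma,V)$ is the spectrum obtained by applying $\mathcal{E}\mathcal{M}$ to the derived tensor product $\mathbb{Z}\otimes^{L}_{\mathbb{Z}[\Gamma]}V$. *)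

(* Defs.v *)
From HB Require Import structures.
(* first, since [freeg] shadows [fintype.lift] *)
From mathcomp Require Import freeg.
From mathcomp Require Import all_boot all_order all_algebra.
From mathcomp Require Import zify.
From mathcomp Require Import boolp classical_sets functions cardinality fsbigop.
From Stdlib Require Import Relation_Operators.

Set Implicit Arguments.
Unset Strict Implicit.
Unset Printing Implicit Defensive.

Import GRing.Theory.
Local Open Scope classical_set_scope.
Local Open Scope ring_scope.

Record category := Category {
  Ob :> Type;
  Hom : Ob -> Ob -> Type;
  idm : forall X, Hom X X;
  comp : forall X Y Z, Hom Y Z -> Hom X Y -> Hom X Z;
  comp_idl : forall X Y (f : Hom X Y), comp (idm Y) f = f;
  comp_idr : forall X Y (f : Hom X Y), comp f (idm X) = f;
  compA : forall X Y Z T (h : Hom Z T) (g : Hom Y Z) (f : Hom X Y),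
    comp h (comp g f) = comp (comp h g) f }.

Record functor (C D : category) := Functor {
  fob :> C -> D;
  fmap : forall X Y, Hom X Y -> Hom (fob X) (fob Y);
  fmap_id : forall X, fmap (idm X) = idm (fob X);
  fmap_comp : forall X Y Z (g : Hom Y Z) (f : Hom X Y),
    fmap (comp g f) = comp (fmap g) (fmap f) }.

Record nat_trans (C D : category) (F G : functor C D) := NatTrans {
  ntc :> forall X : C, Hom (F X) (G X);
  ntc_nat : forall (X Y : C) (f : Hom X Y),
    comp (ntc Y) (fmap F f) = comp (fmap G f) (ntc X) }.

Section FunctorComp.
Variables (C D E : category) (G : functor D E) (F : functor C D).

Lemma fcomp_id X : fmap G (fmap F (idm X)) = idm (G (F X)).
Proof. by rewrite !fmap_id. Qed.

Lemma fcomp_comp X Y Z (g : Hom Y Z) (f : Hom X Y) :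
  fmap G (fmap F (comp g f)) = comp (fmap G (fmap F g)) (fmap G (fmap F f)).
Proof. by rewrite !fmap_comp. Qed.

Definition fcomp : functor C E :=
  @Functor C E (fun X => G (F X)) (fun X Y f => fmap G (fmap F f))
    fcomp_id fcomp_comp.
End FunctorComp.

Notation "G \of F" := (fcomp G F) (at level 50, left associativity).

(* The object [m] of the simplex category is 'I_m.+1. *)
Record mono (m n : nat) := Mono {
  mono_fun :> 'I_m.+1 -> 'I_n.+1;
  mono_homo : {homo mono_fun : i j / (i <= j)%N} }.

Lemma mono_eq m n (f g : mono m n) : (forall i, f i = g i) -> f = g.
Proof.
case: f g => f hf [g hg] /= /funext fg.
by move: hf hg; rewrite fg => hf hg; congr Mono; exact: Prop_irrelevance.
Qed.

Definition mono_id m : mono m m := @Mono m m id (fun _ _ => id).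

Definition mono_comp m n p (g : mono n p) (f : mono m n) : mono m p :=
  @Mono m p (fun i => g (f i)) (fun i j ij => mono_homo g (mono_homo f ij)).

Lemma coface_homo p (i : 'I_p.+2) (j k : 'I_p.+1) :
  (j <= k)%N -> (lift i j <= lift i k)%N.
Proof. by rewrite leq_bump2. Qed.

Definition coface p (i : 'I_p.+2) : mono p p.+1 := @Mono p p.+1 (lift i) (@coface_homo p i).

Definition vertex0 p : mono 0 p :=
  @Mono 0 p (fun=> ord0) (fun _ _ _ => leqnn _).

Definition cone_fun p q (f : mono p q) (i : 'I_p.+2) : 'I_q.+2 :=
  if unlift ord0 i is Some j then lift ord0 (f j) else ord0.

Lemma cone_homo p q (f : mono p q) : {homo cone_fun f : i j / (i <= j)%N}.
Proof.
rewrite /cone_fun => i j.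
case: (unliftP ord0 i) => [i'|] -> //; case: (unliftP ord0 j) => [j'|] -> //.
by rewrite /= !leq_bump2 => /(@mono_homo _ _ f).
Qed.

(* [0] * f : [0] * [p] -> [0] * [q] *)
Definition mono_cone p q (f : mono p q) : mono p.+1 q.+1 := Mono (@cone_homo p q f).

Record sset := SSet {
  simp :> nat -> Type;
  act : forall m n, mono m n -> simp n -> simp m;
  act_id : forall n (x : simp n), act (mono_id n) x = x;
  act_comp : forall m n p (f : mono m n) (g : mono n p) (x : simp p),
    act (mono_comp g f) x = act f (act g x) }.

(* A map from the k-th horn of the (p+1)-simplex to X is a family of
   p-simplices x i, i != k, agreeing on the common faces of the i-th and
   j-th facets. *)
Definition kan (X : sset) : Prop :=
  forall p (k : 'I_p.+2) (x : 'I_p.+2 -> X p),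
    (forall i j, i != k -> j != k ->
      forall m (f g : mono m p),
        mono_comp (coface i) f = mono_comp (coface j) g ->
        act f (x i) = act g (x j)) ->
    exists y : X p.+1, forall i, i != k -> act (coface i) y = x i.

Record pkan := PKan {
  pk_sset :> sset;
  pk_kan : kan pk_sset;
  pt : forall n, pk_sset n;
  act_pt : forall m n (f : mono m n), act f (pt n) = pt m }.
Arguments pt {p n}.

(* The elements of pi_m(X, pt) are represented by the m-simplices with
   boundary at the base point, modulo homotopy relative to the boundary. *)
Definition spherical (X : pkan) m (x : X m) : Prop :=
  forall k (f : mono k m), (k < m)%N -> act f x = pt.

Definition homotopic (X : pkan) m (x y : X m) : Prop :=
  exists h : X m.+1, forall i : 'I_m.+2,
    act (coface i) h =
      if i == m :> nat then x else if i == m.+1 :> nat then y else pt.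

(* A spectrum is a sequence of pointed Kan complexes with structure maps
   X_n -> Omega X_(n+1).  Here Omega is the right adjoint of Kan's
   suspension: a p-simplex of Omega X is a (p+1)-simplex of X whose 0-th
   face and 0-th vertex are at the base point, and f : [p] -> [q] acts on it
   through [0] * f. *)
Record spectrum := Spectrum {
  level :> nat -> pkan;
  susp : forall n p, level n p -> level n.+1 p.+1;
  susp_act : forall n p q (f : mono p q) (x : level n q),
    susp (act f x) = act (mono_cone f) (susp x);
  susp_pt : forall n p, susp (pt : level n p) = pt;
  susp_face : forall n p (x : level n p), act (coface ord0) (susp x) = pt;
  susp_vertex : forall n p (x : level n p), act (vertex0 p.+1) (susp x) = pt }.

Record spectrum_hom (X Y : spectrum) := SpectrumHom {
  sh :> forall n p, X n p -> Y n p;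
  sh_act : forall n p q (f : mono p q) (x : X n q),
    sh (act f x) = act f (sh x);
  sh_pt : forall n p, sh (pt : X n p) = pt;
  sh_susp : forall n p (x : X n p), sh (susp x) = susp (sh x) }.

Lemma spectrum_hom_eq X Y (f g : spectrum_hom X Y) :
  (forall n p (x : X n p), f n p x = g n p x) -> f = g.
Proof.
case: f g => f f1 f2 f3 [g g1 g2 g3] /= fg.
have {}fg : f = g.
  by apply: functional_extensionality_dep => n;
     apply: functional_extensionality_dep => p; apply: funext => x.
move: f1 f2 f3 g1 g2 g3; rewrite fg => *.
by congr SpectrumHom; exact: Prop_irrelevance.
Qed.

Definition spectrum_id X : spectrum_hom X X :=
  @SpectrumHom X X (fun _ _ x => x) (fun _ _ _ _ _ => erefl)
    (fun _ _ => erefl) (fun _ _ _ => erefl).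

Section SpectrumComp.
Variables (X Y Z : spectrum) (g : spectrum_hom Y Z) (f : spectrum_hom X Y).

Lemma spectrum_comp_act n p q (a : mono p q) (x : X n q) :
  g n p (f n p (act a x)) = act a (g n q (f n q x)).
Proof. by rewrite !sh_act. Qed.

Lemma spectrum_comp_pt n p : g n p (f n p pt) = pt.
Proof. by rewrite !sh_pt. Qed.

Lemma spectrum_comp_susp n p (x : X n p) :
  g n.+1 p.+1 (f n.+1 p.+1 (susp x)) = susp (g n p (f n p x)).
Proof. by rewrite !sh_susp. Qed.

Definition spectrum_comp : spectrum_hom X Z :=
  @SpectrumHom X Z (fun n p x => g n p (f n p x))
    spectrum_comp_act spectrum_comp_pt spectrum_comp_susp.
End SpectrumComp.

Definition Spectra : category.
Proof.
refine (@Category spectrum spectrum_hom spectrum_id spectrum_comp _ _ _);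
  by move=> *; apply: spectrum_hom_eq.
Defined.

Fixpoint iter_susp (X : spectrum) n m (r : nat) (x : X n m) :
    X (r + n)%N (r + m)%N :=
  if r is r'.+1 then susp (iter_susp r' x) else x.

(* The spherical m-simplices of the n-th level represent elements of the stable
   homotopy group pi_(m-n)(X) = colim_r pi_(r+m)(X_(r+n)).  Two of them are
   identified there iff they become homotopic after finitely many suspensions;
   a map is a stable equivalence iff it is bijective on all these colimits. *)
Definition stable_equivalence (X Y : spectrum) (f : spectrum_hom X Y) : Prop :=
  (forall n m (x x' : X n m), spherical x -> spherical x' ->
     (exists r, homotopic (iter_susp r (f n m x)) (iter_susp r (f n m x'))) ->
     exists r, homotopic (iter_susp r x) (iter_susp r x')) /\
  (forall n m (y : Y n m), spherical y ->
     exists r, exists2 x : X (r + n)%N (r + m)%N,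
       spherical x & homotopic (f _ _ x) (iter_susp r y)).

(* Functors to the infinity-category Sp are represented by functors to Spectra;
   two of them are equivalent in Fun(C, Sp), the localization of the functor
   category at the objectwise stable equivalences, iff they are connected by a
   zigzag of natural stable equivalences. *)
Definition natural_stable_equivalence (C : category)
    (F G : functor C Spectra) : Prop :=
  exists t : nat_trans F G, forall X, stable_equivalence (t X).

Definition equivalent_functors (C : category) (F G : functor C Spectra) : Prop :=
  clos_refl_sym_trans _ (@natural_stable_equivalence C) F G.

(* A simplicial set with a Mal'cev operation (for instance a simplicial
   group, with x y^-1 z) is a Kan complex. *)
Lemma coface_factor m p (j : 'I_p.+2) (f : mono m p.+1) :
  (forall i, f i != j) -> exists g : mono m p, f = mono_comp (coface j) g.
Proof.
move=> fj.
have fP i : exists k, f i = lift j k.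
  by case: (unliftP j (f i)) (fj i) => [k ->|->]; [exists k|rewrite eqxx].
have [g gE] := choice fP.
have gh : {homo g : i k / (i <= k)%N}.
  by move=> i k /(mono_homo f); rewrite !gE /= leq_bump2.
by exists (Mono gh); apply: mono_eq.
Qed.

Definition codeg_fun p (a : nat) (i : 'I_p.+2) : 'I_p.+1 :=
  inord (if (i <= a)%N then i : nat else i.-1).

Lemma codeg_val p a (i : 'I_p.+2) : (a <= p)%N ->
  codeg_fun a i = (if (i <= a)%N then i : nat else i.-1) :> nat.
Proof.
move=> ap; rewrite inordK //; case: ifP => ia; first by rewrite (leq_ltn_trans ia).
by case: i ia => [[|i]] //= ip _; rewrite -ltnS.
Qed.

Lemma codeg_homo p a : (a <= p)%N ->
  {homo @codeg_fun p a : i j / (i <= j)%N}.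
Proof.
by move=> ap i j ij; rewrite !codeg_val //; case: ifP; case: ifP => *; lia.
Qed.

Definition codeg p a (ap : (a <= p)%N) : mono p.+1 p := Mono (codeg_homo ap).

Section Malcev.
Variables (X : sset) (mal : forall n, X n -> X n -> X n -> X n).
Hypothesis mal_act : forall m n (f : mono m n) (x y z : X n),
  act f (mal x y z) = mal (act f x) (act f y) (act f z).
Hypothesis mal_l : forall n (x z : X n), mal x x z = z.
Hypothesis mal_r : forall n (x z : X n), mal x z z = x.

Variables (p : nat) (k : 'I_p.+2) (x : 'I_p.+2 -> X p).
Hypothesis x_compat : forall i j, i != k -> j != k ->
  forall m (f g : mono m p),
    mono_comp (coface i) f = mono_comp (coface j) g ->
    act f (x i) = act g (x j).

Definition fills (J : pred 'I_p.+2) (y : X p.+1) :=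
  forall i, i != k -> J i -> act (coface i) y = x i.

Lemma fill_step (J : pred 'I_p.+2) (i : 'I_p.+2) (s : mono p.+1 p) y :
  i != k -> (forall l, s (lift i l) = l) ->
  (forall j l, J j -> j != k -> j != i -> lift i (s (lift j l)) != j) ->
  fills J y -> exists z, fills (fun j => (j == i) || J j) z.
Proof.
move=> ik si sJ yJ.
exists (mal y (act s (act (coface i) y)) (act s (x i))) => j jk.
rewrite mal_act -!act_comp.
case: (eqVneq j i) => [-> _|ji /= Jj].
  have -> : mono_comp s (coface i) = mono_id p by apply: mono_eq => l; apply: si.
  by rewrite act_id !act_comp mal_l //=.
have [b bE] : exists b : mono p p,
    mono_comp (coface i) (mono_comp s (coface j)) = mono_comp (coface j) b.
  by apply: coface_factor => l /=; apply: sJ.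
have -> : act (mono_comp s (coface j)) (x i) =
          act (mono_comp s (coface j)) (act (coface i) y).
  rewrite (x_compat ik jk bE) -(yJ j jk Jj) -!act_comp.
  by congr act; rewrite -bE.
by rewrite -act_comp mal_r yJ.
Qed.

Lemma codeg_lift a (ap : (a <= p)%N) (i : 'I_p.+2) (l : 'I_p.+1) :
  (i == a :> nat) || (i == a.+1 :> nat) -> codeg ap (lift i l) = l.
Proof.
move=> ia; apply: val_inj; rewrite [LHS]codeg_val //= /bump.
by case: ifP => *; lia.
Qed.

Lemma codeg_avoid a (ap : (a <= p)%N) (i j : 'I_p.+2) (l : 'I_p.+1) :
  (i == a :> nat) && (j != a.+1 :> nat) || (i == a.+1 :> nat) && (j != a :> nat) ->
  j != i -> lift i (codeg ap (lift j l)) != j.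
Proof.
rewrite -!val_eqE /= /bump codeg_val //= /bump => ij ji.
by case: ifP => *; lia.
Qed.

Lemma fill_low a : (a <= k)%N -> exists y, fills (fun j => j < a)%N y.
Proof.
elim: a => [|a IH] ak; first by exists (act (codeg (leq0n p)) (x k)).
have [y yJ] := IH (ltnW ak).
have kp := ltn_ord k.
have ap : (a <= p)%N by lia.
have ap2 : (a < p.+2)%N by lia.
have [||||z zJ] := @fill_step (fun j => j < a)%N (Ordinal ap2) (codeg ap) y.
- by rewrite -val_eqE /=; lia.
- by move=> l; apply: codeg_lift => /=; rewrite eqxx.
- by move=> j l ja _; apply: codeg_avoid => /=; lia.
- exact: yJ.
exists z => j jk ja; apply: zJ => //=.
by rewrite -val_eqE /=; lia.
Qed.

Lemma fill_all a : (a <= p.+1 - k)%N ->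
  exists y, fills (fun j => (j < k) || (p.+1 - a < j))%N y.
Proof.
have kp := ltn_ord k.
elim: a => [|a IH] ak.
  have [y yJ] := fill_low (leqnn k).
  exists y => j jk H; apply: yJ => //; have := ltn_ord j; lia.
have [y yJ] := IH (ltnW ak).
have bp : (p - a <= p)%N by lia.
have bp2 : ((p - a).+1 < p.+2)%N by lia.
have [||||z zJ] := @fill_step (fun j => (j < k) || (p.+1 - a < j))%N
  (Ordinal bp2) (codeg bp) y.
- by rewrite -val_eqE /=; lia.
- by move=> l; apply: codeg_lift => /=; rewrite eqxx orbT.
- by move=> j l ja _; apply: codeg_avoid => /=; lia.
- exact: yJ.
exists z => j jk ja; apply: zJ => //=.
by rewrite -val_eqE /=; lia.
Qed.

Lemma malcev_fill : exists y, forall i, i != k -> act (coface i) y = x i.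
Proof.
have [y yJ] := fill_all (leqnn _).
exists y => i ik; apply: yJ => //.
by move: ik; rewrite -val_eqE /=; have := ltn_ord k; lia.
Qed.
End Malcev.

Lemma malcev_kan (X : sset) (mal : forall n, X n -> X n -> X n -> X n) :
  (forall m n (f : mono m n) (x y z : X n),
     act f (mal n x y z) = mal m (act f x) (act f y) (act f z)) ->
  (forall n (x z : X n), mal n x x z = z) ->
  (forall n (x z : X n), mal n x z z = x) -> kan X.
Proof. by move=> hact hl hr p k x hx; apply: (malcev_fill hact hl hr hx). Qed.

Record chain_complex := ChainComplex {
  chn :> int -> zmodType;
  dif : forall i j, chn i -> chn j;
  dif_additive : forall i j, zmod_morphism (@dif i j);
  dif_shape : forall i j x, i != j + 1 -> @dif i j x = 0;
  dif_dif : forall i j k x, @dif j k (@dif i j x) = 0 }.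

Record chain_map (C D : chain_complex) := ChainMap {
  chm :> forall i, C i -> D i;
  chm_additive : forall i, zmod_morphism (@chm i);
  chm_dif : forall i j (x : C i), chm (dif j x) = dif j (chm x) }.

Lemma chain_map_eq C D (f g : chain_map C D) :
  (forall i (x : C i), f i x = g i x) -> f = g.
Proof.
case: f g => f f1 f2 [g g1 g2] /= fg.
have {}fg : f = g.
  by apply: functional_extensionality_dep => n; apply: funext => x.
by move: f1 f2 g1 g2; rewrite fg => *; congr ChainMap; exact: Prop_irrelevance.
Qed.

Definition chain_id C : chain_map C C :=
  @ChainMap C C (fun _ x => x) (fun _ _ _ => erefl) (fun _ _ _ => erefl).

Section ChainComp.
Variables (C D E : chain_complex) (g : chain_map D E) (f : chain_map C D).

Lemma chain_comp_additive i : zmod_morphism (fun x : C i => g i (f i x)).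
Proof. by move=> x y; rewrite !chm_additive. Qed.

Lemma chain_comp_dif i j (x : C i) : g j (f j (dif j x)) = dif j (g i (f i x)).
Proof. by rewrite !chm_dif. Qed.

Definition chain_comp : chain_map C E :=
  @ChainMap C E (fun i x => g i (f i x)) chain_comp_additive chain_comp_dif.
End ChainComp.

Definition Ch : category.
Proof.
refine (@Category chain_complex chain_map chain_id chain_comp _ _ _);
  by move=> *; apply: chain_map_eq.
Defined.

(* k - n, written so that (k + 1) - (n + 1) and k - n are convertible *)
Fixpoint degsub (k n : nat) : int :=
  match k, n with
  | k'.+1, n'.+1 => degsub k' n'
  | _, 0 => Posz k
  | 0, _ => - Posz n
  end.

Lemma degsubE k n : degsub k n = k%:Z - n%:Z.
Proof.
elim: k n => [|k IH] [|n] //=; rewrite ?sub0r ?subr0 //.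
by rewrite IH !intS opprD addrACA subrr add0r.
Qed.

Section EilenbergMacLane.
Variable C : chain_complex.

(* The p-simplices of the space Map(Z[0], C[n]): chain maps from the normalized
   chains of the standard p-simplex to the shift C[n], where
   C[n]_k = C_(k-n) with differential (-1)^n d.  The value at s is the value on
   the generator given by s, which is zero in the normalized chains
   when s is degenerate. *)
Record em_simplex (n p : nat) := EMSimplex {
  emc :> forall k, mono k p -> C (degsub k n);
  em_degen : forall k (s : mono k p), ~ injective s -> emc s = 0;
  em_dif0 : forall (s : mono 0 p) j, dif j (emc s) = 0;
  em_dif : forall k (s : mono k.+1 p),
    dif (degsub k n) (emc s) *~ (-1) ^+ n =
    \sum_(i < k.+2) emc (mono_comp s (coface i)) *~ (-1) ^+ i }.

Lemma em_simplex_eq n p (x y : em_simplex n p) :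
  (forall k (s : mono k p), x k s = y k s) -> x = y.
Proof.
case: x y => x x1 x2 x3 [y y1 y2 y3] /= xy.
have {}xy : x = y.
  by apply: functional_extensionality_dep => k; apply: funext => s.
by move: x1 x2 x3 y1 y2 y3; rewrite xy => *; congr EMSimplex; exact: Prop_irrelevance.
Qed.

Section Act.
Variables (n p q : nat) (f : mono p q) (x : em_simplex n q).
Let y k (s : mono k p) := x k (mono_comp f s).

Lemma em_act_degen k (s : mono k p) : ~ injective s -> y s = 0.
Proof. by move=> si; apply: em_degen => /inj_compr. Qed.

Lemma em_act_dif0 (s : mono 0 p) j : dif j (y s) = 0.
Proof. exact: em_dif0. Qed.

Lemma em_act_dif k (s : mono k.+1 p) :
  dif (degsub k n) (y s) *~ (-1) ^+ n =
  \sum_(i < k.+2) y (mono_comp s (coface i)) *~ (-1) ^+ i.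
Proof. by rewrite em_dif. Qed.

Definition em_act := EMSimplex em_act_degen em_act_dif0 em_act_dif.
End Act.

Lemma em_act_id n p (x : em_simplex n p) : em_act (mono_id p) x = x.
Proof. by apply: em_simplex_eq => k s /=; congr emc; apply: mono_eq. Qed.

Lemma em_act_comp n p q r (f : mono p q) (g : mono q r) (x : em_simplex n r) :
  em_act (mono_comp g f) x = em_act f (em_act g x).
Proof. by apply: em_simplex_eq => k s /=; congr emc; apply: mono_eq. Qed.

Definition em_sset n : sset :=
  @SSet (em_simplex n) (@em_act n) (@em_act_id n) (@em_act_comp n).

Lemma dif0 i j : dif j (0 : C i) = 0.
Proof. by rewrite -[X in dif _ X](subrr 0) dif_additive subrr. Qed.

Lemma difB i j (x y : C i) : dif j (x - y) = dif j x - dif j y.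
Proof. exact: dif_additive. Qed.

Section Malcev.
Variables (n p : nat) (x y z : em_simplex n p).
Let w k (s : mono k p) := x k s - (y k s - z k s).

Lemma em_mal_degen k (s : mono k p) : ~ injective s -> w s = 0.
Proof. by move=> si; rewrite /w !em_degen // !subr0. Qed.

Lemma em_mal_dif0 (s : mono 0 p) j : dif j (w s) = 0.
Proof. by rewrite /w !difB !em_dif0 !subr0. Qed.

Lemma em_mal_dif k (s : mono k.+1 p) :
  dif (degsub k n) (w s) *~ (-1) ^+ n =
  \sum_(i < k.+2) w (mono_comp s (coface i)) *~ (-1) ^+ i.
Proof.
rewrite /w !difB !mulrzBl !em_dif -!sumrB.
by apply: eq_bigr => i _; rewrite !mulrzBl.
Qed.

Definition em_mal := EMSimplex em_mal_degen em_mal_dif0 em_mal_dif.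
End Malcev.

Lemma em_kan n : kan (em_sset n).
Proof.
apply: (@malcev_kan (em_sset n) (@em_mal n)) => [p q f x y z|p x z|p x z];
  apply: em_simplex_eq => k s //=.
  by rewrite opprB addrCA subrr addr0.
by rewrite subrr subr0.
Qed.

Section Zero.
Variables n p : nat.
Let w k (s : mono k p) : C (degsub k n) := 0.

Lemma em_zero_dif0 (s : mono 0 p) j : dif j (w s) = 0.
Proof. exact: dif0. Qed.

Lemma em_zero_dif k (s : mono k.+1 p) :
  dif (degsub k n) (w s) *~ (-1) ^+ n =
  \sum_(i < k.+2) w (mono_comp s (coface i)) *~ (-1) ^+ i.
Proof. by rewrite dif0 mul0rz big1 // => i _; rewrite mul0rz. Qed.

Definition em_zero : em_simplex n p :=
  EMSimplex (fun _ _ _ => erefl) em_zero_dif0 em_zero_dif.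
End Zero.

Lemma em_zero_act n p q (f : mono p q) : em_act f (em_zero n q) = em_zero n p.
Proof. exact: em_simplex_eq. Qed.

Definition em_space n : pkan := PKan (@em_kan n) (@em_zero_act n).

(* For s : [k+1] -> [p+1] with s 0 = 0 and s 1 > 0, the restriction
   of s to {1, ..., k+1}, as a map [k] -> [p] *)
Definition mono_tail_fun k p (s : mono k.+1 p.+1) (i : 'I_k.+1) : 'I_p.+1 :=
  inord (s (lift ord0 i)).-1.

Lemma mono_tail_homo k p (s : mono k.+1 p.+1) :
  {homo mono_tail_fun s : i j / (i <= j)%N}.
Proof.
move=> i j ij; rewrite /mono_tail_fun.
have si := ltn_ord (s (lift ord0 i)); have sj := ltn_ord (s (lift ord0 j)).
rewrite !inordK; [|lia..].
have : (s (lift ord0 i) <= s (lift ord0 j))%N by apply: mono_homo; rewrite leq_bump2.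
lia.
Qed.

Definition mono_tail k p (s : mono k.+1 p.+1) : mono k p := Mono (@mono_tail_homo k p s).

Definition is_cone k p (s : mono k.+1 p.+1) : bool :=
  (s ord0 == ord0) && (s (lift ord0 ord0) != ord0).

(* The isomorphism Map(Z[0], C[n]) -> Omega Map(Z[0], C[n+1]): the value
   on a nondegenerate simplex [0] * t is the value of x on t, and all the
   other values are zero. *)
Definition em_susp_fun n p (x : em_simplex n p) k :
    mono k p.+1 -> C (degsub k n.+1) :=
  match k with
  | 0 => fun=> 0
  | k'.+1 => fun s => if is_cone s then x k' (mono_tail s) else 0
  end.

Lemma mono_tail_lift k p (s : mono k.+1 p.+1) i : is_cone s ->
  lift ord0 (mono_tail s i) = s (lift ord0 i).
Proof.
case/andP=> _ s1; apply: val_inj; rewrite /= /mono_tail_fun.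
have si := ltn_ord (s (lift ord0 i)).
have : (s (lift ord0 ord0) <= s (lift ord0 i))%N by apply: mono_homo.
move: s1; rewrite -val_eqE /= => s1 ss.
by rewrite inordK /bump; lia.
Qed.

Lemma em_susp_degen n p (x : em_simplex n p) k (s : mono k p.+1) :
  ~ injective s -> em_susp_fun x s = 0.
Proof.
case: k s => //= k s si; case: ifP => // sc.
apply: em_degen => ti; apply: si => i j.
case: (unliftP ord0 i) => [i'|] ->; case: (unliftP ord0 j) => [j'|] -> //.
- by rewrite -!mono_tail_lift // => /lift_inj/ti ->.
- by case/andP: (sc) => /eqP -> _; rewrite -mono_tail_lift.
- by case/andP: (sc) => /eqP -> _; rewrite -mono_tail_lift.
Qed.

Lemma em_susp_dif0 n p (x : em_simplex n p) (s : mono 0 p.+1) j :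
  dif j (em_susp_fun x s) = 0.
Proof. exact: dif0. Qed.

Lemma coface_lift0 p (i : 'I_p.+2) (j : 'I_p.+1) :
  lift (lift ord0 i) (lift ord0 j) = lift ord0 (lift i j) :> 'I_p.+3.
Proof. by apply: val_inj; rewrite /= /bump; lia. Qed.

Lemma coface_ord0 p (i : 'I_p.+1) : lift (lift ord0 i) ord0 = ord0 :> 'I_p.+2.
Proof. by apply: val_inj. Qed.

Lemma em_susp_dif n p (x : em_simplex n p) k (s : mono k.+1 p.+1) :
  dif (degsub k n.+1) (em_susp_fun x s) *~ (-1) ^+ n.+1 =
  \sum_(i < k.+2) em_susp_fun x (mono_comp s (coface i)) *~ (-1) ^+ i.
Proof.
case: k s => [|k] s.
  have -> : dif (degsub 0 n.+1) (em_susp_fun x s) = 0.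
    by rewrite /=; case: ifP => _; rewrite ?em_dif0 ?dif0.
  by rewrite mul0rz big1 // => i _; rewrite mul0rz.
case: (boolP (s ord0 == ord0)) => s0; last first.
  (* nothing of the form [0] * t occurs *)
  have s0i i : s i != ord0.
    move: s0; rewrite -!val_eqE /= => s0.
    have : (s ord0 <= s i)%N by apply: mono_homo.
    lia.
  rewrite /= /is_cone (negPf s0) /= dif0 mul0rz.
  by rewrite big1 // => i _; rewrite (negPf (s0i _)) mul0rz.
rewrite big_ord_recl.
case: (boolP (s (lift ord0 ord0) == ord0)) => s1.
  (* s 0 = s 1 = 0, so that the faces 0 and 1 of s coincide *)
  have -> : dif (degsub k.+1 n.+1) (em_susp_fun x s) = 0.
    by rewrite /= /is_cone s1 andbF dif0.
  rewrite mul0rz big_ord_recl big1 => [|i _]; last first.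
    rewrite /= /is_cone /=.
    have -> : lift (lift ord0 (lift ord0 i)) (lift ord0 ord0) = lift ord0 ord0.
      by apply: val_inj.
    by rewrite s1 andbF mul0rz.
  have -> : mono_comp s (coface (lift ord0 ord0)) = mono_comp s (coface ord0).
    apply: mono_eq => i /=; case: (unliftP ord0 i) => [j|] ->.
      by rewrite coface_lift0; congr (s _); apply: val_inj.
    by rewrite coface_ord0 (eqP s0) (eqP s1).
  by rewrite addr0 expr0 mulr1z expr1 mulrN1z subrr.
have sc : is_cone s by rewrite /is_cone s0.
rewrite /= sc.
have -> : is_cone (mono_comp s (coface ord0)) = false.
  by rewrite /is_cone /= (negPf s1).
rewrite mul0rz add0r exprS mulN1r mulrNz em_dif -sumrN.
apply: eq_bigr => i _.
rewrite /bump /= add1n exprS mulN1r mulrNz; congr (- (_ *~ _)).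
have -> : is_cone (mono_comp s (coface (lift ord0 i))).
  rewrite /is_cone /= coface_ord0 s0 /=.
  have : (s (lift ord0 ord0) <= s (lift (lift ord0 i) (lift ord0 ord0)))%N.
    by apply: mono_homo; rewrite /= /bump; lia.
  by move: s1; rewrite -!val_eqE /=; lia.
congr emc; apply: mono_eq => j.
by rewrite /= /mono_tail_fun /= coface_lift0.
Qed.

Definition em_susp n p (x : em_simplex n p) : em_simplex n.+1 p.+1 :=
  EMSimplex (@em_susp_degen n p x) (@em_susp_dif0 n p x) (@em_susp_dif n p x).

Lemma cone_fun_lift p q (f : mono p q) i : cone_fun f (lift ord0 i) = lift ord0 (f i).
Proof. by rewrite /cone_fun liftK. Qed.

Lemma cone_fun0 p q (f : mono p q) : cone_fun f ord0 = ord0.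
Proof. by rewrite /cone_fun unlift_none. Qed.

Lemma cone_fun_eq0 p q (f : mono p q) i : (cone_fun f i == ord0) = (i == ord0).
Proof.
case: (unliftP ord0 i) => [j|] ->; last by rewrite cone_fun0 !eqxx.
by rewrite cone_fun_lift -!val_eqE.
Qed.

Lemma em_susp_act n p q (f : mono p q) (x : em_simplex n q) :
  em_susp (em_act f x) = em_act (mono_cone f) (em_susp x).
Proof.
apply: em_simplex_eq => -[|k] s //=.
have -> : is_cone (mono_comp (mono_cone f) s) = is_cone s.
  by rewrite /is_cone /= !cone_fun_eq0.
case: ifP => // sc; congr emc; apply: mono_eq => i.
by rewrite /= {2}/mono_tail_fun /= -mono_tail_lift // cone_fun_lift /= inord_val.
Qed.

Lemma em_susp_pt n p : em_susp (em_zero n p) = em_zero n.+1 p.+1.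
Proof. by apply: em_simplex_eq => -[|k] s //=; rewrite if_same. Qed.

Lemma em_susp_face n p (x : em_simplex n p) :
  em_act (coface ord0) (em_susp x) = em_zero n.+1 p.
Proof. by apply: em_simplex_eq => -[|k] s. Qed.

Lemma em_susp_vertex n p (x : em_simplex n p) :
  em_act (vertex0 p.+1) (em_susp x) = em_zero n.+1 0.
Proof. by apply: em_simplex_eq => -[|k] s. Qed.

Definition em_spectrum : spectrum :=
  @Spectrum em_space em_susp em_susp_act em_susp_pt em_susp_face em_susp_vertex.
End EilenbergMacLane.

Section EMMap.
Variables (C D : chain_complex) (h : chain_map C D).

Lemma chm0 i : h i 0 = 0.
Proof. by rewrite -[X in h _ X](subrr 0) chm_additive subrr. Qed.

Lemma chmB i (x y : C i) : h i (x - y) = h i x - h i y.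
Proof. exact: chm_additive. Qed.

HB.instance Definition _ i := GRing.isZmodMorphism.Build (C i) (D i) (h i)
  (@chm_additive _ _ h i).

Section Simplex.
Variables (n p : nat) (x : em_simplex C n p).
Let y k (s : mono k p) := h _ (x k s).

Lemma em_map_degen k (s : mono k p) : ~ injective s -> y s = 0.
Proof. by move=> si; rewrite /y em_degen // chm0. Qed.

Lemma em_map_dif0 (s : mono 0 p) j : dif j (y s) = 0.
Proof. by rewrite /y -chm_dif em_dif0 chm0. Qed.

Lemma em_map_dif k (s : mono k.+1 p) :
  dif (degsub k n) (y s) *~ (-1) ^+ n =
  \sum_(i < k.+2) y (mono_comp s (coface i)) *~ (-1) ^+ i.
Proof.
rewrite /y -chm_dif -raddfMz em_dif raddf_sum.
by apply: eq_bigr => i _; rewrite raddfMz.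
Qed.

Definition em_map_simplex : em_simplex D n p :=
  EMSimplex em_map_degen em_map_dif0 em_map_dif.
End Simplex.

Lemma em_map_act n p q (f : mono p q) (x : em_simplex C n q) :
  em_map_simplex (em_act f x) = em_act f (em_map_simplex x).
Proof. exact: em_simplex_eq. Qed.

Lemma em_map_pt n p : em_map_simplex (em_zero C n p) = em_zero D n p.
Proof. by apply: em_simplex_eq => k s /=; rewrite chm0. Qed.

Lemma em_map_susp n p (x : em_simplex C n p) :
  em_map_simplex (em_susp x) = em_susp (em_map_simplex x).
Proof.
apply: em_simplex_eq => -[|k] s /=; first by rewrite chm0.
by case: ifP => // _; rewrite chm0.
Qed.

Definition em_map : spectrum_hom (em_spectrum C) (em_spectrum D) :=
  @SpectrumHom (em_spectrum C) (em_spectrum D) em_map_simplex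
    em_map_act em_map_pt em_map_susp.
End EMMap.

Definition EM : functor Ch Spectra.
Proof.
refine (@Functor Ch Spectra em_spectrum em_map _ _).
  by move=> C; apply: spectrum_hom_eq => n p x; apply: em_simplex_eq.
by move=> C D E g f; apply: spectrum_hom_eq => n p x; apply: em_simplex_eq.
Defined.

Record nat_complex := NatComplex {
  nch :> nat -> zmodType;
  bd : forall n, nch n.+1 -> nch n;
  bd_additive : forall n, zmod_morphism (@bd n);
  bd_bd : forall n x, @bd n (@bd n.+1 x) = 0 }.

Record nat_chain_map (C D : nat_complex) := NatChainMap {
  nchm :> forall n, C n -> D n;
  nchm_additive : forall n, zmod_morphism (@nchm n);
  nchm_bd : forall n (x : C n.+1), nchm (bd x) = bd (nchm x) }.

Lemma nat_chain_map_eq C D (f g : nat_chain_map C D) :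
  (forall n (x : C n), f n x = g n x) -> f = g.
Proof.
case: f g => f f1 f2 [g g1 g2] /= fg.
have {}fg : f = g.
  by apply: functional_extensionality_dep => n; apply: funext => x.
by move: f1 f2 g1 g2; rewrite fg => *; congr NatChainMap; exact: Prop_irrelevance.
Qed.

Definition nat_chain_id C : nat_chain_map C C :=
  @NatChainMap C C (fun _ x => x) (fun _ _ _ => erefl) (fun _ _ => erefl).

Section NatChainComp.
Variables (C D E : nat_complex) (g : nat_chain_map D E) (f : nat_chain_map C D).

Lemma nat_chain_comp_additive n : zmod_morphism (fun x : C n => g n (f n x)).
Proof. by move=> x y; rewrite !nchm_additive. Qed.

Lemma nat_chain_comp_bd n (x : C n.+1) :
  g n (f n (bd x)) = bd (g n.+1 (f n.+1 x)).
Proof. by rewrite !nchm_bd. Qed.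

Definition nat_chain_comp : nat_chain_map C E :=
  @NatChainMap C E (fun n x => g n (f n x)) nat_chain_comp_additive
    nat_chain_comp_bd.
End NatChainComp.

Definition NCh : category.
Proof.
refine (@Category nat_complex nat_chain_map nat_chain_id nat_chain_comp _ _ _);
  by move=> *; apply: nat_chain_map_eq.
Defined.

Section ExtendByZero.
Variable C : nat_complex.

Definition ext_obj (i : int) : zmodType :=
  match i with Posz n => C n | Negz _ => 'rV[int]_0 end.

Definition ext_bd m n (e : m = n.+1) (x : C m) : C n :=
  bd (eq_rect m (fun k => C k : Type) x n.+1 e).

Definition ext_dif (i j : int) : ext_obj i -> ext_obj j :=
  match i, j return ext_obj i -> ext_obj j with
  | Posz m, Posz n =>
      fun x => if m =P n.+1 is ReflectT e then ext_bd e x else 0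
  | _, _ => fun=> 0
  end.

Lemma ext_dif_succ n (x : C n.+1) : @ext_dif n.+1 n x = bd x.
Proof.
rewrite /ext_dif; case: eqP => // e.
by rewrite /ext_bd (eq_axiomK e).
Qed.

Lemma ext_dif_additive i j : zmod_morphism (@ext_dif i j).
Proof.
case: i j => [m|m] [n|n] x y; rewrite /= ?subr0 //.
case: eqP => [e|_]; last by rewrite subr0.
by subst m; rewrite /ext_bd /= bd_additive.
Qed.

Lemma ext_dif_shape i j x : i != j + 1 -> @ext_dif i j x = 0.
Proof.
case: i j x => [m|m] [n|n] x //=; case: eqP => // e.
by move/eqP; case; rewrite [in LHS]e -addn1 PoszD.
Qed.

Lemma ext_dif_dif i j k x : @ext_dif j k (@ext_dif i j x) = 0.
Proof.
have d0 a b : @ext_dif a b 0 = 0.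
  by rewrite -[X in ext_dif _ X](subrr 0) ext_dif_additive subrr.
have dN a b y : @ext_dif a (Negz b) y = 0 by case: a y.
have [ij|ij] := eqVneq i (j + 1); last by rewrite (ext_dif_shape _ ij) d0.
have [jk|jk] := eqVneq j (k + 1); last by rewrite (ext_dif_shape _ jk).
case: k jk => [n|n] jk; last exact: dN.
have {}jk : j = n.+1 by rewrite jk -PoszD addn1.
have {}ij : i = n.+2 by rewrite ij jk -PoszD addn1.
by subst; rewrite !ext_dif_succ bd_bd.
Qed.

Definition ext_complex : chain_complex :=
  ChainComplex ext_dif_additive ext_dif_shape ext_dif_dif.
End ExtendByZero.

Section ExtendMap.
Variables (C D : nat_complex) (f : nat_chain_map C D).

Definition ext_map_fun (i : int) : ext_obj C i -> ext_obj D i :=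
  match i with Posz n => f n | Negz _ => id end.

Lemma ext_map_additive i : zmod_morphism (@ext_map_fun i).
Proof. by case: i => n x y //=; rewrite nchm_additive. Qed.

Lemma ext_map_dif i j (x : ext_obj C i) :
  ext_map_fun (ext_dif j x) = ext_dif j (ext_map_fun x).
Proof.
have f0 n : f n 0 = 0 by rewrite -[X in f n X](subrr 0) nchm_additive subrr.
case: i j x => [m|m] [n|n] x //=; case: eqP => // e.
by subst m; rewrite /ext_bd /= nchm_bd.
Qed.

Definition ext_map : chain_map (ext_complex C) (ext_complex D) :=
  @ChainMap (ext_complex C) (ext_complex D) ext_map_fun ext_map_additive ext_map_dif.
End ExtendMap.

Definition extend : functor NCh Ch.
Proof.
refine (@Functor NCh Ch ext_complex ext_map _ _).
  by move=> C; apply: chain_map_eq => -[n|n] x.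
by move=> C D E g f; apply: chain_map_eq => -[n|n] x.
Defined.

Record gset (Gamma : groupType) := GSet {
  gset_sort :> choiceType;
  gact : Gamma -> gset_sort -> gset_sort;
  gact1 : forall x, gact 1%g x = x;
  gactM : forall g h x, gact (g * h)%g x = gact g (gact h x) }.

Record gset_hom (Gamma : groupType) (X Y : gset Gamma) := GSetHom {
  gsh :> X -> Y;
  gsh_act : forall (g : Gamma) x, gsh (gact g x) = gact g (gsh x) }.

Section GSetCategory.
Variable Gamma : groupType.
Implicit Types X Y Z : gset Gamma.

Lemma gset_hom_eq X Y (f g : gset_hom X Y) : (forall x, f x = g x) -> f = g.
Proof.
case: f g => f f1 [g g1] /= /funext fg.
by move: f1 g1; rewrite fg => *; congr GSetHom; exact: Prop_irrelevance.
Qed.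

Definition gset_id X : gset_hom X X := @GSetHom _ X X id (fun _ _ => erefl).

Lemma gset_comp_act X Y Z (g : gset_hom Y Z) (f : gset_hom X Y) a x :
  g (f (gact a x)) = gact a (g (f x)).
Proof. by rewrite !gsh_act. Qed.

Definition gset_comp X Y Z (g : gset_hom Y Z) (f : gset_hom X Y) : gset_hom X Z :=
  GSetHom (gset_comp_act g f).

Definition GSets : category.
Proof.
refine (@Category (gset Gamma) (@gset_hom Gamma) gset_id gset_comp _ _ _);
  by move=> *; apply: gset_hom_eq.
Defined.

Lemma gactK X (g : Gamma) (x : X) : gact g^-1%g (gact g x) = x.
Proof. by rewrite -gactM mulVg gact1. Qed.

Lemma gactVK X (g : Gamma) (x : X) : gact g (gact g^-1%g x) = x.
Proof. by rewrite -gactM mulgV gact1. Qed.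
End GSetCategory.

Section CoarseBorn.
Variable X : Type.
Implicit Types (U V : set (X * X)) (B : set X).

Definition diag : set (X * X) := [set p | p.1 = p.2].
Definition rel_inv U : set (X * X) := [set p | U (p.2, p.1)].
Definition rel_comp U V : set (X * X) :=
  [set p | exists y, U (p.1, y) /\ V (y, p.2)].
Definition thicken U B : set X := [set x | exists2 b, B b & U (x, b)].

Definition is_coarse (C : set (set (X * X))) : Prop :=
  [/\ C diag,
      forall U V, V `<=` U -> C U -> C V,
      forall U V, C U -> C V -> C (U `|` V),
      forall U, C U -> C (rel_inv U) &
      forall U V, C U -> C V -> C (rel_comp U V)].

Definition is_bornology (b : set (set X)) : Prop :=
  [/\ b set0,
      forall B B', B' `<=` B -> b B -> b B',
      forall B B', b B -> b B' -> b (B `|` B') &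
      forall x, exists2 B, b B & B x].

Lemma smallest_is_coarse (G : set (set (X * X))) :
  is_coarse (smallest is_coarse G).
Proof.
split.
- by move=> C [[]].
- by move=> U V VU HU C HC; case: (HC) => -[_ h _ _ _] _; apply: h VU (HU _ HC).
- by move=> U V HU HV C HC; case: (HC) => -[_ _ h _ _] _; apply: h (HU _ HC) (HV _ HC).
- by move=> U HU C HC; case: (HC) => -[_ _ _ h _] _; apply: h (HU _ HC).
- by move=> U V HU HV C HC; case: (HC) => -[_ _ _ _ h] _; apply: h (HU _ HC) (HV _ HC).
Qed.

Lemma smallest_is_bornology (G : set (set X)) :
  (forall x, exists2 B, G B & B x) -> is_bornology (smallest is_bornology G).
Proof.
move=> Gx; split.
- by move=> C [[]].
- by move=> U V VU HU C HC; case: (HC) => -[_ h _ _] _; apply: h VU (HU _ HC).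
- by move=> U V HU HV C HC; case: (HC) => -[_ _ h _] _; apply: h (HU _ HC) (HV _ HC).
- by move=> x; have [B GB Bx] := Gx x; exists B => //; apply: sub_gen_smallest.
Qed.
End CoarseBorn.
Arguments diag {X}.

Definition image2 X Y (f : X -> Y) (U : set (X * X)) : set (Y * Y) :=
  (fun p => (f p.1, f p.2)) @` U.

Record bcs (Gamma : groupType) := Bcs {
  bcs_gset :> gset Gamma;
  entourage : set (set (bcs_gset * bcs_gset));
  bounded : set (set bcs_gset);
  ent_coarse : is_coarse entourage;
  bdd_bornology : is_bornology bounded;
  bcs_compat : forall U B, entourage U -> bounded B -> bounded (thicken U B);
  ent_act : forall (g : Gamma) U, entourage U -> entourage (image2 (gact g) U);
  bdd_act : forall (g : Gamma) B, bounded B -> bounded (gact g @` B);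
  ent_cofinal : forall U, entourage U ->
    exists V, [/\ entourage V, forall g : Gamma, image2 (gact g) V = V & U `<=` V] }.

Record bcs_hom (Gamma : groupType) (X Y : bcs Gamma) := BcsHom {
  bch :> gset_hom X Y;
  bch_controlled : forall U, entourage U -> entourage (image2 bch U);
  bch_proper : forall B, bounded B -> bounded (bch @^-1` B) }.

Section BcsCategory.
Variable Gamma : groupType.
Implicit Types X Y Z : bcs Gamma.

Lemma bcs_hom_eq X Y (f g : bcs_hom X Y) : (forall x, f x = g x) -> f = g.
Proof.
case: f g => f f1 f2 [g g1 g2] /= /gset_hom_eq fg.
by move: f1 f2 g1 g2; rewrite fg => *; congr BcsHom; exact: Prop_irrelevance.
Qed.

Lemma bcs_id_controlled X U : entourage U -> entourage (image2 (gset_id X) U).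
Proof. by rewrite /image2 (_ : (fun p => _) = id) ?image_id //; apply/funext => -[]. Qed.

Definition bcs_id X : bcs_hom X X :=
  @BcsHom _ X X (gset_id X) (@bcs_id_controlled X) (fun _ => id).

Section Comp.
Variables (X Y Z : bcs Gamma) (g : bcs_hom Y Z) (f : bcs_hom X Y).

Lemma bcs_comp_controlled U :
  entourage U -> entourage (image2 (gset_comp g f) U).
Proof.
move=> /(bch_controlled f)/(bch_controlled g).
by rewrite /image2 image_comp.
Qed.

Lemma bcs_comp_proper B : bounded B -> bounded (gset_comp g f @^-1` B).
Proof. by move=> /(bch_proper g)/(bch_proper f). Qed.

Definition bcs_comp : bcs_hom X Z := BcsHom bcs_comp_controlled bcs_comp_proper.
End Comp.

Definition BornCoarse : category.
Proof.
refine (@Category (bcs Gamma) (@bcs_hom Gamma) bcs_id bcs_comp _ _ _);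
  by move=> *; apply: bcs_hom_eq.
Defined.

Lemma image2P (X Y : Type) (f : X -> Y) (U : set (X * X)) x y :
  U (x, y) -> image2 f U (f x, f y).
Proof. by move=> Uxy; exists (x, y). Qed.

Definition rel_invariant (X : gset Gamma) (U : set (X * X)) :=
  forall (g : Gamma) x y, U (x, y) -> U (gact g x, gact g y).

Lemma rel_invariantE (X : gset Gamma) (U : set (X * X)) :
  rel_invariant U -> forall g : Gamma, image2 (gact g) U = U.
Proof.
move=> Ui g; apply/seteqP; split=> [_ [[x y] /= Uxy <-]|[x y] Uxy].
  exact: Ui.
exists (gact g^-1%g x, gact g^-1%g y); first exact: Ui.
by rewrite /= !gactVK.
Qed.

Lemma gen_cofinal (X : gset Gamma) (G : set (set (X * X))) :
  (forall U, G U -> exists V, [/\ smallest (@is_coarse X) G V, rel_invariant V & U `<=` V]) ->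
  forall U, smallest (@is_coarse X) G U ->
    exists V, [/\ smallest (@is_coarse X) G V, rel_invariant V & U `<=` V].
Proof.
move=> GV; have [c1 c2 c3 c4 c5] := smallest_is_coarse G.
apply: smallest_sub => //; split.
- by exists diag; split=> // g x y; rewrite /diag /= => ->.
- by move=> U V VU [W [? ? UW]]; exists W; split=> //; apply: subset_trans UW.
- move=> U V [U' [? Ui ?]] [V' [? Vi ?]]; exists (U' `|` V'); split.
  + exact: c3.
  + by move=> g x y [/Ui|/Vi] h; [left|right]; apply: h.
  + exact: setUSS.
- move=> U [U' [? Ui UU]]; exists (rel_inv U'); split; first exact: c4.
    by move=> g x y /Ui h; apply: h.
  by move=> p /UU.
- move=> U V [U' [? Ui UU]] [V' [? Vi VV]]; exists (rel_comp U' V'); split.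
  + exact: c5.
  + by move=> g x y [z [/Ui a /Vi b]]; exists (gact g z); split; [apply: a|apply: b].
  + by move=> p [z [/UU a /VV b]]; exists z.
Qed.

Lemma gen_ent_act (X : gset Gamma) (C : set (set (X * X))) : is_coarse C ->
  (forall U, C U -> exists V, [/\ C V, rel_invariant V & U `<=` V]) ->
  forall (g : Gamma) U, C U -> C (image2 (gact g) U).
Proof.
case=> _ c2 _ _ _ CV g U /CV [V [cV Vi UV]]; apply: c2 cV.
by move=> _ [[x y] /= /UV /Vi h <-]; apply: h.
Qed.

Lemma gen_ent_cofinal (X : gset Gamma) (C : set (set (X * X))) :
  (forall U, C U -> exists V, [/\ C V, rel_invariant V & U `<=` V]) ->
  forall U, C U ->
  exists V, [/\ C V, forall g : Gamma, image2 (gact g) V = V & U `<=` V].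
Proof.
move=> CV U /CV [V [cV Vi UV]]; exists V; split=> //; exact: rel_invariantE.
Qed.

Definition left_gset : gset Gamma :=
  @GSet Gamma Gamma (fun g x => g * x)%g (@mul1g Gamma)
    (fun g h x => esym (mulgA g h x)).

Definition can_generator (B : set Gamma) : set (Gamma * Gamma) :=
  [set p | exists g b b', [/\ B b, B b' & p = (g * b, g * b')%g]].

Definition can_entourage : set (set (left_gset * left_gset)) :=
  smallest (@is_coarse Gamma) [set U | exists2 B, finite_set B & U = can_generator B].

Definition min_bounded : set (set left_gset) := [set B : set Gamma | finite_set B].

Lemma can_coarse : is_coarse can_entourage.
Proof. exact: smallest_is_coarse. Qed.

Lemma finite_bornology (T : choiceType) : is_bornology [set B : set T | finite_set B].
Proof.
split=> /=.
- exact: finite_set0.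
- by move=> B B' BB; apply: sub_finite_set.
- by move=> B B' fB fB'; rewrite finite_setU.
- by move=> x; exists [set x] => //; apply: finite_set1.
Qed.

Lemma min_bornology : is_bornology min_bounded.
Proof. exact: finite_bornology. Qed.

Lemma thicken_fin (T : choiceType) (U : set (T * T)) :
  (forall b, finite_set [set x | U (x, b)]) ->
  forall B, finite_set B -> finite_set (thicken U B).
Proof.
move=> Ub B fB; have -> : thicken U B = \bigcup_(b in B) [set x | U (x, b)].
  by apply/seteqP; split=> [x [b]|x [b]]; exists b.
exact: bigcup_finite.
Qed.

Lemma can_fin (U : set (Gamma * Gamma)) : can_entourage U ->
  (forall b, finite_set [set x | U (x, b)]) /\
  (forall b, finite_set [set x | U (b, x)]).
Proof.
pose fin (V : set (Gamma * Gamma)) := forall b, finite_set [set x | V (x, b)].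
rewrite -[X in _ -> X]/(fin U /\ fin (rel_inv U)).
have fcomp V W : fin V -> fin W -> fin (rel_comp V W).
  move=> fV fW b; apply: sub_finite_set (thicken_fin fV (fW b)).
  by move=> x [y [/= Vxy Wyb]]; exists y.
move: U; apply: smallest_sub; first split.
- by split=> b; apply: sub_finite_set (finite_set1 b) => x.
- move=> U V VU [h1 h2]; split=> b; [move: (h1 b)|move: (h2 b)];
    by apply: sub_finite_set => x /VU.
- move=> U V [h1 h2] [h3 h4]; split=> b.
    by apply: sub_finite_set (_ : finite_set ([set x | U (x, b)] `|` [set x | V (x, b)]));
      rewrite ?finite_setU.
  by apply: sub_finite_set (_ : finite_set ([set x | U (b, x)] `|` [set x | V (b, x)]));
    rewrite ?finite_setU //; split; [apply: h2|apply: h4].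
- by move=> U [h1 h2].
- move=> U V [h1 h2] [h3 h4]; split; first exact: fcomp.
  move=> b; apply: sub_finite_set (fcomp _ _ h4 h2 b).
  by move=> x [y [/= a c]]; exists y.
move=> U [B fB ->].
have key b : finite_set [set x | can_generator B (x, b)].
  pose h (q : Gamma * Gamma) := (b * q.1^-1 * q.2)%g.
  apply: sub_finite_set (finite_image h (finite_setX fB fB)).
  move=> x [g [c [c' [Bc Bc' [-> bE]]]]]; exists (c', c) => //=.
  by rewrite /h bE /= mulgK.
split=> // b; apply: sub_finite_set (key b).
by move=> x [g [c [c' [Bc Bc' [bE ->]]]]]; exists g, c', c; rewrite bE.
Qed.

Lemma can_compat U B : can_entourage U -> min_bounded B -> min_bounded (thicken U B).
Proof. by move=> /can_fin[h _]; apply: thicken_fin. Qed.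

Lemma can_inv U : can_entourage U ->
  exists V, [/\ can_entourage V, rel_invariant V & U `<=` V].
Proof.
move: U; apply: (@gen_cofinal left_gset) => _ [B fB ->].
exists (can_generator B); split=> //.
  by apply: sub_gen_smallest; exists B.
move=> g x y [h [b [b' [Bb Bb' [-> ->]]]]]; exists (g * h)%g, b, b'.
by rewrite /= !mulgA.
Qed.

Lemma min_act (g : Gamma) B : min_bounded B -> min_bounded (gact g @` B).
Proof. exact: finite_image. Qed.

Lemma can_ent_act (g : Gamma) U : can_entourage U -> can_entourage (image2 (gact g) U).
Proof. exact: (@gen_ent_act left_gset _ can_coarse can_inv). Qed.

Lemma can_cofinal U : can_entourage U ->
  exists V, [/\ can_entourage V, forall g : Gamma, image2 (gact g) V = V & U `<=` V].
Proof. exact: (@gen_ent_cofinal left_gset _ can_inv). Qed.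

Definition can_min : bcs Gamma :=
  @Bcs _ left_gset can_entourage min_bounded can_coarse min_bornology can_compat
    can_ent_act min_act can_cofinal.
End BcsCategory.

Section MinMax.
Variable Gamma : groupType.

Section Object.
Variable S : gset Gamma.

Definition min_entourage : set (set (S * S)) := smallest (@is_coarse S) [set diag].

Definition max_bounded : set (set S) := setT.

Lemma min_coarse : is_coarse min_entourage.
Proof. exact: smallest_is_coarse. Qed.

Lemma min_diag U : min_entourage U -> U `<=` diag.
Proof.
move: U; apply: smallest_sub => [|U ->] //; split=> //.
- by move=> U V VU UD p /VU/UD.
- by move=> U V UD VD p [/UD|/VD].
- by move=> U UD p /UD.
- by move=> U V UD VD p [y [/UD + /VD]]; rewrite /diag /= => ->.
Qed.

Lemma max_bornology : is_bornology max_bounded.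
Proof. by split=> // x; exists setT. Qed.

Lemma minmax_compat U B : min_entourage U -> max_bounded B -> max_bounded (thicken U B).
Proof. by []. Qed.

Lemma min_inv U : min_entourage U ->
  exists V, [/\ min_entourage V, rel_invariant V & U `<=` V].
Proof.
move=> /min_diag UD; exists diag; split=> //; first by case: min_coarse.
by move=> g x y; rewrite /diag /= => ->.
Qed.

Lemma max_act (g : Gamma) B : max_bounded B -> max_bounded (gact g @` B).
Proof. by []. Qed.

Definition min_max : bcs Gamma :=
  @Bcs _ S min_entourage max_bounded min_coarse max_bornology minmax_compat
    (gen_ent_act min_coarse min_inv) max_act (gen_ent_cofinal min_inv).
End Object.

Section Map.
Variables (S T : gset Gamma) (f : gset_hom S T).

Lemma min_max_controlled (U : set (min_max S * min_max S)) :
  entourage U -> entourage (image2 f U : set (min_max T * min_max T)).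
Proof.
move=> /min_diag UD; have [c1 c2 _ _ _] := min_coarse T.
by apply: c2 c1 => _ [p /UD + <-]; rewrite /diag /= => ->.
Qed.

Lemma min_max_proper (B : set (min_max T)) :
  bounded B -> bounded (f @^-1` B : set (min_max S)).
Proof. by []. Qed.

Definition min_max_map : bcs_hom (min_max S) (min_max T) :=
  @BcsHom _ (min_max S) (min_max T) f min_max_controlled min_max_proper.
End Map.

Definition MinMax : functor (GSets Gamma) (BornCoarse Gamma).
Proof.
by refine (@Functor (GSets Gamma) (BornCoarse Gamma) min_max min_max_map _ _);
  move=> *; apply: bcs_hom_eq.
Defined.
End MinMax.

Section Tensor.
Variable Gamma : groupType.

Section Object.
Variables X Y : bcs Gamma.

Lemma prod_act1 (p : X * Y) : (gact 1%g p.1, gact 1%g p.2) = p.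
Proof. by rewrite !gact1; case: p. Qed.

Lemma prod_actM (g h : Gamma) (p : X * Y) :
  (gact (g * h)%g p.1, gact (g * h)%g p.2) = (gact g (gact h p.1), gact g (gact h p.2)).
Proof. by rewrite !gactM. Qed.

Definition prod_gset : gset Gamma :=
  @GSet Gamma (X * Y)%type (fun g p => (gact g p.1, gact g p.2)) prod_act1 prod_actM.

Definition rel_prod (U : set (X * X)) (V : set (Y * Y)) :
    set (prod_gset * prod_gset) :=
  [set p | U (p.1.1, p.2.1) /\ V (p.1.2, p.2.2)].

Definition tensor_entourage : set (set (prod_gset * prod_gset)) :=
  smallest (@is_coarse prod_gset)
    [set W | exists U V, [/\ entourage U, entourage V & W = rel_prod U V]].

Definition tensor_bounded : set (set prod_gset) :=
  smallest (@is_bornology prod_gset)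
    [set W | exists (B : set X) (B' : set Y),
       [/\ bounded B, bounded B' & W = (B `*` B' : set (X * Y))]].

Lemma tensor_coarse : is_coarse tensor_entourage.
Proof. exact: smallest_is_coarse. Qed.

Lemma tensor_bornology : is_bornology tensor_bounded.
Proof.
apply: smallest_is_bornology => -[x y].
have [_ _ _ /(_ x)[B bB Bx]] := bdd_bornology X.
have [_ _ _ /(_ y)[B' bB' By]] := bdd_bornology Y.
by exists (B `*` B') => //; exists B, B'.
Qed.

Lemma tensor_ent_sub W : tensor_entourage W ->
  exists U V, [/\ entourage U, entourage V & W `<=` rel_prod U V].
Proof.
have [a1 a2 a3 a4 a5] := ent_coarse X; have [b1 b2 b3 b4 b5] := ent_coarse Y.
move: W; apply: smallest_sub => [|_ [U [V [hU hV ->]]]]; last first.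
  by exists U, V; split=> // p.
split.
- by exists diag, diag; split=> // -[[x y] [x' y']]; rewrite /diag /= => -[-> ->].
- move=> U V VU [A [B [hA hB UAB]]]; exists A, B; split=> //.
  exact: subset_trans UAB.
- move=> U V [A [B [hA hB UAB]]] [A' [B' [hA' hB' VAB]]].
  exists (A `|` A'), (B `|` B'); split; [exact: a3|exact: b3|].
  by move=> p [/UAB[? ?]|/VAB[? ?]]; split; [left|left|right|right].
- move=> U [A [B [hA hB UAB]]]; exists (rel_inv A), (rel_inv B).
  by split; [exact: a4|exact: b4|move=> p /UAB[]].
- move=> U V [A [B [hA hB UAB]]] [A' [B' [hA' hB' VAB]]].
  exists (rel_comp A A'), (rel_comp B B'); split; [exact: a5|exact: b5|].
  move=> p [z [/UAB[/= h1 h2] /VAB[/= h3 h4]]].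
  by split; [exists z.1|exists z.2].
Qed.

Lemma tensor_bdd_sub W : tensor_bounded W ->
  exists (B : set X) (B' : set Y), [/\ bounded B, bounded B' & W `<=` B `*` B'].
Proof.
have [a1 a2 a3 a4] := bdd_bornology X; have [b1 b2 b3 b4] := bdd_bornology Y.
move: W; apply: smallest_sub => [|_ [U [V [hU hV ->]]]]; last first.
  by exists U, V; split=> // p.
split.
- by exists set0, set0; split.
- move=> U V VU [A [B [hA hB UAB]]]; exists A, B; split=> //.
  exact: subset_trans UAB.
- move=> U V [A [B [hA hB UAB]]] [A' [B' [hA' hB' VAB]]].
  exists (A `|` A'), (B `|` B'); split; [exact: a3|exact: b3|].
  by move=> p [/UAB[? ?]|/VAB[? ?]]; split; [left|left|right|right].
- move=> [x y]; have [A hA Ax] := a4 x; have [B hB By] := b4 y.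
  exists (A `*` B); last by split.
  by exists A, B; split=> // p.
Qed.

Lemma tensor_ent_prod U V : entourage U -> entourage V ->
  tensor_entourage (rel_prod U V).
Proof. by move=> hU hV; apply: sub_gen_smallest; exists U, V. Qed.

Lemma tensor_bdd_prod (B : set X) (B' : set Y) : bounded B -> bounded B' ->
  tensor_bounded (B `*` B').
Proof. by move=> hU hV; apply: sub_gen_smallest; exists B, B'. Qed.

Lemma tensor_compat W B :
  tensor_entourage W -> tensor_bounded B -> tensor_bounded (thicken W B).
Proof.
move=> /tensor_ent_sub[U [V [hU hV WUV]]] /tensor_bdd_sub[A [A' [hA hA' BA]]].
have [_ c2 _ _] := tensor_bornology.
apply: c2 (tensor_bdd_prod (bcs_compat hU hA) (bcs_compat hV hA')).
by move=> x [b /BA[/= Ab A'b] /WUV[/= Uxb Vxb]]; split; [exists b.1|exists b.2].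
Qed.

Lemma tensor_inv W : tensor_entourage W ->
  exists V, [/\ tensor_entourage V, rel_invariant V & W `<=` V].
Proof.
move=> /tensor_ent_sub[U [V [hU hV WUV]]].
have [U' [hU' Ui UU]] := ent_cofinal hU; have [V' [hV' Vi VV]] := ent_cofinal hV.
exists (rel_prod U' V'); split; first exact: tensor_ent_prod.
  move=> g x y [/= Uxy Vxy]; split=> /=.
    by rewrite -(Ui g); exists (x.1, y.1).
  by rewrite -(Vi g); exists (x.2, y.2).
by move=> p /WUV[/UU ? /VV ?].
Qed.

Lemma tensor_act (g : Gamma) B : tensor_bounded B -> tensor_bounded (gact g @` B).
Proof.
move=> /tensor_bdd_sub[A [A' [hA hA' BA]]].
have [_ c2 _ _] := tensor_bornology.
apply: c2 (tensor_bdd_prod (bdd_act g hA) (bdd_act g hA')).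
by move=> _ [x /BA[/= Ax A'x] <-]; split; [exists x.1|exists x.2].
Qed.

Definition tensor : bcs Gamma :=
  @Bcs _ prod_gset tensor_entourage tensor_bounded tensor_coarse tensor_bornology
    tensor_compat (gen_ent_act tensor_coarse tensor_inv) tensor_act
    (gen_ent_cofinal tensor_inv).
End Object.

Section Map.
Variables (X Y Y' : bcs Gamma) (f : bcs_hom Y Y').
Let h (p : tensor X Y) : tensor X Y' := (p.1, f p.2).

Lemma tensor_map_act (g : Gamma) p : h (gact g p) = gact g (h p).
Proof. by rewrite /h /= gsh_act. Qed.

Definition tensor_map_gset : gset_hom (tensor X Y) (tensor X Y') := GSetHom tensor_map_act.

Lemma tensor_map_controlled U : entourage U -> entourage (image2 tensor_map_gset U).
Proof.
move=> /tensor_ent_sub[A [B [hA hB UAB]]].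
have [_ c2 _ _ _] := tensor_coarse X Y'.
apply: c2 (tensor_ent_prod hA (bch_controlled f hB)).
by move=> _ [p /UAB[/= Ap Bp] <-]; split=> //=; exists (p.1.2, p.2.2).
Qed.

Lemma tensor_map_proper B : bounded B -> bounded (tensor_map_gset @^-1` B).
Proof.
move=> /tensor_bdd_sub[A [A' [hA hA' BA]]].
have [_ c2 _ _] := tensor_bornology X Y.
apply: c2 (tensor_bdd_prod hA (bch_proper f hA')).
by move=> p /BA.
Qed.

Definition tensor_map : bcs_hom (tensor X Y) (tensor X Y') :=
  BcsHom tensor_map_controlled tensor_map_proper.
End Map.

Definition TensorLeft (X : bcs Gamma) : functor (BornCoarse Gamma) (BornCoarse Gamma).
Proof.
refine (@Functor (BornCoarse Gamma) (BornCoarse Gamma) (tensor X)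
  (@tensor_map X) _ _).
  by move=> Y; apply: bcs_hom_eq => -[].
by move=> *; apply: bcs_hom_eq.
Defined.
End Tensor.

Section Chains.
Variables (Gamma : groupType) (X : bcs Gamma) (n : nat).
Implicit Types (c : {ffun 'I_n.+1 -> X} -> int) (x : {ffun 'I_n.+1 -> X}).

Definition controlled c : Prop :=
  exists2 U, entourage U & forall x, c x != 0 -> forall i j, U (x i, x j).

Definition locally_finite c : Prop :=
  forall B, bounded B -> finite_set [set x | c x != 0 /\ exists i, B (x i)].

Definition invariant_chain c : Prop :=
  forall (g : Gamma) x, c [ffun i => gact g (x i)] = c x.

Definition coarse_chain c : Prop :=
  [/\ controlled c, locally_finite c & invariant_chain c].

Definition coarse_chain_pred : {pred {ffun 'I_n.+1 -> X} -> int} :=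
  fun c => `[< coarse_chain c >].

Lemma coarse_chain_closed : zmod_closed coarse_chain_pred.
Proof.
have [c1 c2 c3 _ _] := ent_coarse X.
split=> [|c d /asboolP[[U hU cU] cf ci] /asboolP[[V hV dV] df di]].
  apply/asboolP; split=> //; first by exists diag => // x /eqP.
  by move=> B _; apply: sub_finite_set (@finite_set0 _) => x [/eqP].
have cd x : (c - d) x != 0 -> c x != 0 \/ d x != 0.
  have -> : (c - d) x = c x - d x by [].
  have [->|] := eqVneq (c x) 0; last by left.
  by rewrite sub0r oppr_eq0; right.
apply/asboolP; split.
- exists (U `|` V) => [|x /cd[/cU h|/dV h] i j]; first exact: c3.
  + by left; apply: h.
  + by right; apply: h.
- move=> B hB; have := conj (cf B hB) (df B hB); rewrite -finite_setU.
  by apply: sub_finite_set => x [/cd[h|h] hx]; [left|right].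
- move=> g x; have -> : (c - d) x = c x - d x by [].
  by rewrite -(ci g x) -(di g x).
Qed.

HB.instance Definition _ := GRing.isZmodClosed.Build
  ({ffun 'I_n.+1 -> X} -> int) coarse_chain_pred coarse_chain_closed.

Record chain := Chain {
  chain_fun :> {ffun 'I_n.+1 -> X} -> int;
  chain_mem : chain_fun \in coarse_chain_pred }.

HB.instance Definition _ := [isSub for chain_fun].
HB.instance Definition _ := [Choice of chain by <:].
HB.instance Definition _ := [SubChoice_isSubZmodule of chain by <:].

Lemma chainP (c : chain) : coarse_chain c.
Proof. exact/asboolP/chain_mem. Qed.

Lemma chain_eq (c d : chain) : (forall x, c x = d x) -> c = d.
Proof. by move=> cd; apply: val_inj; apply: funext. Qed.

Lemma chain_subE (c d : chain) x : (c - d) x = c x - d x.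
Proof. by []. Qed.
End Chains.

(* linear extension of a map f to (possibly infinite) linear combinations *)
Definition push (A B : choiceType) (f : A -> B) (c : A -> int) (b : B) : int :=
  \sum_(a \in f @^-1` [set b]) c a.

Section Push.
Variables (A B : choiceType) (f : A -> B).
Implicit Types c d : A -> int.

Definition fiber_finite c :=
  forall b, finite_set [set a | c a != 0 /\ f a = b].

Lemma push_supp c b : push f c b != 0 -> exists2 a, f a = b & c a != 0.
Proof.
apply: contra_neqP => h; rewrite /push fsbig1 // => a fa.
by apply/eqP/negP => /negP ca; apply: h; exists a.
Qed.

Lemma pushE c (r : seq A) b : uniq r ->
  (forall a, c a != 0 -> f a = b -> a \in r) ->
  push f c b = \sum_(a <- r | f a == b) c a.
Proof.
move=> ru rs; rewrite /push (_ : f @^-1` [set b] = [set` [pred a | f a == b]]).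
  symmetry; apply: bigfs => // a /= /eqP fa ar; apply/eqP.
  by apply: contraNT ar => ca; apply: rs.
by apply/seteqP; split=> a /= /eqP.
Qed.

Lemma fiber_enum c (F : B -> bool) : finite_set [set a | c a != 0 /\ F (f a)] ->
  exists2 r : seq A, uniq r & forall a, c a != 0 -> F (f a) -> a \in r.
Proof.
move=> /finite_seqP[s sE]; exists (undup s); first exact: undup_uniq.
move=> a ca fa; rewrite mem_undup.
have : [set a | c a != 0 /\ F (f a)] a by [].
by rewrite sE.
Qed.

Lemma pushB c d b : fiber_finite c -> fiber_finite d ->
  push f (c - d) b = push f c b - push f d b.
Proof.
move=> cf df.
have /finite_seqP[s sE] : finite_set
    ([set a | c a != 0 /\ f a = b] `|` [set a | d a != 0 /\ f a = b]).
  by rewrite finite_setU; split; [apply: cf|apply: df].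
have sc a : c a != 0 -> f a = b -> a \in undup s.
  move=> ca fa; rewrite mem_undup.
  by have : [set` s] a by rewrite -sE; left.
have sd a : d a != 0 -> f a = b -> a \in undup s.
  move=> ca fa; rewrite mem_undup.
  by have : [set` s] a by rewrite -sE; right.
rewrite !(@pushE _ (undup s)) ?undup_uniq //; last first.
  move=> a; have -> : (c - d) a = c a - d a by [].
  have [->|ca _] := eqVneq (c a) 0; last exact: sc.
  by rewrite sub0r oppr_eq0; apply: sd.
by rewrite -sumrB.
Qed.
End Push.

Lemma push_comp (A B D : choiceType) (f : A -> B) (g : B -> D) (c : A -> int) z :
  (forall z, finite_set [set a | c a != 0 /\ g (f a) = z]) ->
  push g (push f c) z = push (g \o f) c z.
Proof.
move=> /(_ z)/finite_seqP[s sE].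
have sc a : c a != 0 -> g (f a) = z -> a \in undup s.
  move=> ca fa; rewrite mem_undup.
  by have : [set` s] a by rewrite -sE.
rewrite [RHS](@pushE _ _ _ _ (undup s)) ?undup_uniq //.
rewrite (@pushE _ _ _ _ (undup [seq f a | a <- s])) ?undup_uniq //; last first.
  move=> b /push_supp[a <- ca] gb; rewrite mem_undup; apply: map_f.
  by rewrite -mem_undup; apply: sc.
transitivity (\sum_(b <- undup [seq f a | a <- s] | g b == z)
    \sum_(a <- undup s | f a == b) c a).
  apply: eq_bigr => b /eqP gb; apply: pushE; first exact: undup_uniq.
  by move=> a ca fa; apply: sc; rewrite ?fa.
rewrite (exchange_big_dep (fun a => g (f a) == z)) /=; last first.
  by move=> b a gb /eqP ->.
rewrite big_seq_cond [RHS]big_seq_cond; apply: eq_bigr => a /andP[as_ /eqP ga].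
have fr : f a \in undup [seq f a | a <- s].
  by rewrite mem_undup; apply: map_f; rewrite -mem_undup.
rewrite (eq_bigl (pred1 (f a))) => [|b /=].
  by rewrite -big_filter filter_pred1_uniq ?undup_uniq // big_seq1.
by rewrite andbC eq_sym; case: eqP => //= ->; rewrite ga eqxx.
Qed.

(* The maps of tuples that induce the boundary and the functoriality: f is
   applied to the coordinates selected by s. *)
Definition reindex_tuple (X Y : choiceType) n m (f : X -> Y)
    (s : 'I_m.+1 -> 'I_n.+1) (x : {ffun 'I_n.+1 -> X}) : {ffun 'I_m.+1 -> Y} :=
  [ffun i => f (x (s i))].

Section PushChain.
Variables (Gamma : groupType) (X Y : bcs Gamma) (f : bcs_hom X Y) (n m : nat).
Variable s : 'I_m.+1 -> 'I_n.+1.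
Let phi := reindex_tuple f s.

Lemma chain_fiber_finite (c : chain X n) : fiber_finite phi c.
Proof.
move=> y; have [_ cf _] := chainP c.
have [_ _ _ /(_ (y ord0))[B hB By]] := bdd_bornology Y.
apply: sub_finite_set (cf _ (bch_proper f hB)) => x [cx fx]; split=> //.
by exists (s ord0); rewrite /preimage /=; move: By; rewrite -fx ffunE.
Qed.

Lemma push_coarse_chain (c : chain X n) : push phi c \in @coarse_chain_pred _ Y m.
Proof.
have [[U hU cU] cf ci] := chainP c; apply/asboolP; split.
- exists (image2 f U); first exact: bch_controlled.
  move=> _ /push_supp[x <- cx] i j; rewrite !ffunE.
  by exists (x (s i), x (s j)) => //; apply: cU.
- move=> B hB; apply: sub_finite_set (finite_image phi (cf _ (bch_proper f hB))).
  move=> _ [/push_supp[x <- cx] [i Bi]]; exists x => //; split=> //.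
  by exists (s i); move: Bi; rewrite ffunE.
- move=> g y.
  pose act_t (h : Gamma) (x : {ffun 'I_n.+1 -> X}) := [ffun i => gact h (x i)].
  have phi_act h x : phi (act_t h x) = [ffun i => gact h (phi x i)].
    by apply/ffunP => i; rewrite !ffunE gsh_act.
  rewrite /push (@reindex_fsbig _ _ _ _ _ (act_t g) (phi @^-1` [set y])).
    by apply: eq_fsbigr => x _; apply: ci.
  split.
  + by move=> x /= <-; rewrite phi_act.
  + move=> x x' _ _ /ffunP e; apply/ffunP => i.
    by have := e i; rewrite !ffunE => /(congr1 (gact g^-1%g)); rewrite !gactK.
  + move=> x /= xy; exists (act_t g^-1%g x) => /=; last first.
      by apply/ffunP => i; rewrite !ffunE gactVK.
    by rewrite phi_act xy; apply/ffunP => i; rewrite !ffunE gactK.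
Qed.

Definition push_chain (c : chain X n) : chain Y m := Chain (push_coarse_chain c).

Lemma push_chain_additive : zmod_morphism push_chain.
Proof.
move=> c d; apply: chain_eq => y.
by rewrite [LHS](@pushB _ _ phi) //; apply: chain_fiber_finite.
Qed.

HB.instance Definition _ := GRing.isZmodMorphism.Build (chain X n) (chain Y m)
  push_chain push_chain_additive.
End PushChain.

Lemma push_chain_comp (Gamma : groupType) (X Y Z : bcs Gamma) (g : bcs_hom Y Z)
    (f : bcs_hom X Y) n m p (t : 'I_p.+1 -> 'I_m.+1) (s : 'I_m.+1 -> 'I_n.+1)
    (c : chain X n) :
  push_chain g t (push_chain f s c) = push_chain (bcs_comp g f) (s \o t) c.
Proof.
have E : reindex_tuple g t \o reindex_tuple f s = reindex_tuple (bcs_comp g f) (s \o t).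
  by apply/funext => x; apply/ffunP => i; rewrite /= !ffunE.
apply: chain_eq => z /=; rewrite push_comp; first by rewrite E.
move=> {}z; apply: sub_finite_set (@chain_fiber_finite _ _ _ (bcs_comp g f) _ _ (s \o t) c z).
by rewrite -E.
Qed.

Section CoarseComplex.
Variables (Gamma : groupType) (X : bcs Gamma).

(* the i-th summand omits the i-th entry *)
Definition coarse_bd n (c : chain X n.+1) : chain X n :=
  \sum_(i < n.+2) push_chain (bcs_id X) (lift i) c *~ (-1) ^+ i.

Lemma coarse_bd_additive n : zmod_morphism (@coarse_bd n).
Proof.
move=> c d; rewrite /coarse_bd -sumrB; apply: eq_bigr => i _.
by rewrite raddfB mulrzBl.
Qed.

Lemma coarse_bd_bd n (c : chain X n.+2) : coarse_bd (coarse_bd c) = 0.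
Proof.
pose F (i : 'I_n.+2) (j : 'I_n.+3) := push_chain (bcs_id X) (lift j \o lift i) c.
have -> : coarse_bd (coarse_bd c) =
    \sum_(i < n.+2) \sum_(j < n.+3) F i j *~ (-1) ^+ (i + j).
  apply: eq_bigr => i _; rewrite {1}/coarse_bd raddf_sum mulrz_suml.
  apply: eq_bigr => j _; rewrite raddfMz /= push_chain_comp.
  rewrite (_ : bcs_comp _ _ = bcs_id X); last exact: bcs_hom_eq.
  by rewrite -mulrzA -exprD (addnC j).
rewrite pair_big /= (bigID (fun q : 'I_n.+2 * 'I_n.+3 => q.2 <= q.1)%N) /=.
pose h (q : 'I_n.+2 * 'I_n.+3) : 'I_n.+2 * 'I_n.+3 := (inord q.2, lift ord0 q.1).
pose k (q : 'I_n.+2 * 'I_n.+3) : 'I_n.+2 * 'I_n.+3 := (inord q.2.-1, inord q.1).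
rewrite [X in _ + X](reindex_onto h k) /=; last first.
  move=> [i j] /=; rewrite -ltnNge => ij; rewrite /h /k /=.
  have hi := ltn_ord i; have hj := ltn_ord j.
  by congr (_, _); apply: val_inj; rewrite /= ?inordK /bump //; lia.
rewrite [X in _ + X](eq_bigl (fun q : 'I_n.+2 * 'I_n.+3 => q.2 <= q.1)%N); last first.
  move=> [i j] /=; rewrite /h /k /= /bump.
  have hi := ltn_ord i; have hj := ltn_ord j.
  rewrite xpair_eqE -!val_eqE /= add1n /=.
  have [hj2|hj2] := ltnP j n.+2; first by rewrite !inordK ?eqxx //; lia.
  have hj' := ltn_ord (inord j : 'I_n.+2).
  rewrite [X in _ && (_ && (X == _))]inordK; last by lia.
  have -> : (nat_of_ord (inord j : 'I_n.+2) == j) = false by apply/eqP; lia.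
  by rewrite !andbF; apply/esym/negbTE; lia.
rewrite -big_split /= big1 // => -[i j] /= ji.
have hi := ltn_ord i.
have jE : (inord j : 'I_n.+2) = j :> nat by rewrite inordK; lia.
have -> : F (inord j) (lift ord0 i) = F i j.
  rewrite /F; congr push_chain; apply/funext => l; apply: val_inj.
  by rewrite /= jE /bump; lia.
by rewrite jE /bump add1n addnS addnC exprS mulN1r mulrNz subrr.
Qed.

Definition coarse_complex : nat_complex :=
  NatComplex coarse_bd_additive coarse_bd_bd.
End CoarseComplex.

Section CoarseMap.
Variables (Gamma : groupType) (X Y : bcs Gamma) (f : bcs_hom X Y).

Lemma coarse_map_additive n : zmod_morphism (push_chain f id : chain X n -> chain Y n).
Proof. exact: push_chain_additive. Qed.

Lemma coarse_map_bd n (c : chain X n.+1) :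
  push_chain f id (coarse_bd c) = coarse_bd (push_chain f id c).
Proof.
rewrite /coarse_bd raddf_sum; apply: eq_bigr => i _; rewrite raddfMz /=.
rewrite !push_chain_comp.
have -> : bcs_comp f (bcs_id X) = f by apply: bcs_hom_eq.
by have -> : bcs_comp (bcs_id Y) f = f by apply: bcs_hom_eq.
Qed.

Definition coarse_map : nat_chain_map (coarse_complex X) (coarse_complex Y) :=
  @NatChainMap (coarse_complex X) (coarse_complex Y) (fun n => push_chain f id)
    coarse_map_additive coarse_map_bd.
End CoarseMap.

Lemma push_chain_id (Gamma : groupType) (X : bcs Gamma) n (c : chain X n) :
  push_chain (bcs_id X) id c = c.
Proof.
apply: chain_eq => x /=; rewrite /push (_ : _ @^-1` _ = [set x]) ?fsbig_set1 //.
have E y : reindex_tuple (bcs_id X) id y = y by apply/ffunP => i; rewrite ffunE.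
by apply/seteqP; split=> y /=; rewrite E.
Qed.

Definition CoarseComplex (Gamma : groupType) : functor (BornCoarse Gamma) NCh.
Proof.
refine (@Functor (BornCoarse Gamma) NCh (@coarse_complex Gamma)
  (@coarse_map Gamma) _ _).
  by move=> X; apply: nat_chain_map_eq => n c; apply: push_chain_id.
by move=> X Y Z g f; apply: nat_chain_map_eq => n c /=; rewrite push_chain_comp.
Defined.

Definition CoarseHomology (Gamma : groupType) : functor (BornCoarse Gamma) Spectra :=
  EM \of (extend \of CoarseComplex Gamma).

(* A Z[Gamma]-module is presented as an abelian group with an additive action
   of Gamma; gmod is for left modules and rmod for right modules. *)
Record gmod (Gamma : groupType) := GMod {
  gm_sort :> zmodType;
  lact : Gamma -> gm_sort -> gm_sort;
  lact_additive : forall g, zmod_morphism (lact g);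
  lact1 : forall x, lact 1%g x = x;
  lactM : forall g h x, lact (g * h)%g x = lact g (lact h x) }.

Record gmod_hom (Gamma : groupType) (M N : gmod Gamma) := GModHom {
  gmh :> M -> N;
  gmh_additive : zmod_morphism gmh;
  gmh_act : forall (g : Gamma) x, gmh (lact g x) = lact g (gmh x) }.

Record rmod (Gamma : groupType) := RMod {
  rm_sort :> zmodType;
  ract : rm_sort -> Gamma -> rm_sort;
  ract_additive : forall g, zmod_morphism (ract^~ g);
  ract1 : forall x, ract x 1%g = x;
  ractM : forall g h x, ract x (g * h)%g = ract (ract x g) h }.

Record rmod_hom (Gamma : groupType) (M N : rmod Gamma) := RModHom {
  rmh :> M -> N;
  rmh_additive : zmod_morphism rmh;
  rmh_act : forall (g : Gamma) x, rmh (ract x g) = ract (rmh x) g }.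

Section GModCategory.
Variable Gamma : groupType.
Implicit Types L M N : gmod Gamma.

Lemma gmod_hom_eq M N (f g : gmod_hom M N) : (forall x, f x = g x) -> f = g.
Proof.
case: f g => f f1 f2 [g g1 g2] /= /funext fg.
by move: f1 f2 g1 g2; rewrite fg => *; congr GModHom; exact: Prop_irrelevance.
Qed.

Definition gmod_id M : gmod_hom M M :=
  @GModHom _ M M id (fun _ _ => erefl) (fun _ _ => erefl).

Lemma gmod_comp_additive L M N (g : gmod_hom M N) (f : gmod_hom L M) :
  zmod_morphism (fun x => g (f x)).
Proof. by move=> x y; rewrite !gmh_additive. Qed.

Lemma gmod_comp_act L M N (g : gmod_hom M N) (f : gmod_hom L M) a x :
  g (f (lact a x)) = lact a (g (f x)).
Proof. by rewrite !gmh_act. Qed.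

Definition gmod_comp L M N (g : gmod_hom M N) (f : gmod_hom L M) : gmod_hom L N :=
  GModHom (gmod_comp_additive g f) (gmod_comp_act g f).

Definition GMods : category.
Proof.
refine (@Category (gmod Gamma) (@gmod_hom Gamma) gmod_id gmod_comp _ _ _);
  by move=> *; apply: gmod_hom_eq.
Defined.
End GModCategory.

Definition freeg_map (S T : choiceType) (f : S -> T) : {freeg S} -> {freeg T} :=
  fglift (fun s => << f s >>).

Lemma freeg_map_additive (S T : choiceType) (f : S -> T) : zmod_morphism (freeg_map f).
Proof. exact: lift_is_additive. Qed.

HB.instance Definition _ (S T : choiceType) (f : S -> T) :=
  GRing.isZmodMorphism.Build {freeg S} {freeg T} (freeg_map f) (freeg_map_additive f).

Lemma freeg_mapU (S T : choiceType) (f : S -> T) s :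
  freeg_map f << s >> = << f s >>.
Proof. by rewrite /freeg_map liftU scale1r. Qed.

Lemma freeg_ext (S : choiceType) (M : zmodType) (f g : {freeg S} -> M) :
  zmod_morphism f -> zmod_morphism g -> (forall s, f << s >> = g << s >>) ->
  forall x, f x = g x.
Proof.
move=> fa ga fg.
pose F : {additive {freeg S} -> M} := HB.pack f (GRing.isZmodMorphism.Build _ _ f fa).
pose G : {additive {freeg S} -> M} := HB.pack g (GRing.isZmodMorphism.Build _ _ g ga).
rewrite -[f]/(F : _ -> _) -[g]/(G : _ -> _).
apply: freeg_ind_dom0 => [|k s x _ _ IH]; first by rewrite !raddf0.
have -> : << k *g s >> = << s >> *~ k :> {freeg S}.
  by rewrite freegU_mulz intz.
by rewrite !raddfD !raddfMz IH; congr (_ *~ _ + _); apply: fg.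
Qed.

Lemma freeg_map_id (S : choiceType) (x : {freeg S}) : freeg_map id x = x.
Proof.
apply: (@freeg_ext S _ (freeg_map id) id) => //; first exact: freeg_map_additive.
by move=> s; rewrite freeg_mapU.
Qed.

Lemma freeg_map_comp (S T U : choiceType) (g : T -> U) (f : S -> T) (x : {freeg S}) :
  freeg_map (fun s => g (f s)) x = freeg_map g (freeg_map f x).
Proof.
apply: (@freeg_ext S _ (freeg_map (fun s => g (f s)))
  (fun x => freeg_map g (freeg_map f x))).
- exact: freeg_map_additive.
- by move=> y z; rewrite !raddfB.
- by move=> s; rewrite !freeg_mapU.
Qed.

Section PermutationModule.
Variable Gamma : groupType.

Section Object.
Variable S : gset Gamma.

Lemma perm_act1 (x : {freeg S}) : freeg_map (gact 1%g) x = x.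
Proof.
by rewrite -[RHS]freeg_map_id; congr (freeg_map _ x); apply: funext => s; rewrite gact1.
Qed.

Lemma perm_actM (g h : Gamma) (x : {freeg S}) :
  freeg_map (gact (g * h)%g) x = freeg_map (gact g) (freeg_map (gact h) x).
Proof.
by rewrite -freeg_map_comp; congr (freeg_map _ x); apply: funext => s; rewrite gactM.
Qed.

Definition perm_gmod : gmod Gamma :=
  @GMod Gamma {freeg S} (fun g => freeg_map (gact g))
    (fun g => freeg_map_additive (gact g)) perm_act1 perm_actM.
End Object.

Lemma perm_map_act (S T : gset Gamma) (f : gset_hom S T) (g : Gamma) (x : perm_gmod S) :
  freeg_map f (lact g x) = lact g (freeg_map f x : perm_gmod T).
Proof.
rewrite /= -!freeg_map_comp; congr (freeg_map _ x).
by apply: funext => s; rewrite gsh_act.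
Qed.

Definition perm_map (S T : gset Gamma) (f : gset_hom S T) :
    gmod_hom (perm_gmod S) (perm_gmod T) :=
  @GModHom _ (perm_gmod S) (perm_gmod T) (freeg_map f) (freeg_map_additive f)
    (@perm_map_act S T f).

Definition PermutationModule : functor (GSets Gamma) (GMods Gamma).
Proof.
refine (@Functor (GSets Gamma) (GMods Gamma) perm_gmod perm_map _ _).
  by move=> S; apply: gmod_hom_eq => x; apply: freeg_map_id.
by move=> S T U g f; apply: gmod_hom_eq => x; apply: freeg_map_comp.
Defined.
End PermutationModule.

Section TensorGroup.
Variables (Gamma : groupType) (P : rmod Gamma) (V : gmod Gamma).

Definition tensor_relation : set {freeg (P * V)} :=
  [set z |
    (exists x y v, z = << (x + y, v) >> - << (x, v) >> - << (y, v) >>) \/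
    (exists x v w, z = << (x, v + w) >> - << (x, v) >> - << (x, w) >>) \/
    (exists (g : Gamma) x v, z = << (ract x g, v) >> - << (x, lact g v) >>)].

Definition is_subgroup (A : zmodType) (H : set A) : Prop :=
  H 0 /\ forall x y, H x -> H y -> H (x - y).

Definition tensor_relations : {pred {freeg (P * V)}} :=
  fun z => `[< smallest (@is_subgroup {freeg (P * V)}) tensor_relation z >].

Lemma tensor_relations_closed : zmod_closed tensor_relations.
Proof.
split=> [|x y /asboolP hx /asboolP hy]; apply/asboolP => H HH.
  by case: HH => -[].
by have [[_ hB] _] := HH; apply: hB; [apply: hx|apply: hy].
Qed.

HB.instance Definition _ := GRing.isZmodClosed.Build {freeg (P * V)}
  tensor_relations tensor_relations_closed.

Definition tensor_group : zmodType := {ideal_quot tensor_relations}.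

Definition tensor_pi (z : {freeg (P * V)}) : tensor_group :=
  \pi_({ideal_quot tensor_relations})%qT z.

Lemma tensor_pi_additive : zmod_morphism tensor_pi.
Proof. by move=> x y; rewrite /tensor_pi !piE. Qed.

Lemma tensor_pi_eq x y : x - y \in tensor_relations -> tensor_pi x = tensor_pi y.
Proof. by rewrite Quotient.idealrBE => /eqP. Qed.

Lemma tensor_pi_repr (q : tensor_group) : tensor_pi (repr q) = q.
Proof. exact: reprK. Qed.

Lemma repr_tensor_pi z : repr (tensor_pi z) - z \in tensor_relations.
Proof. by rewrite Quotient.idealrBE; apply/eqP; exact: reprK. Qed.
End TensorGroup.

Lemma zmod_morphismD (A B : zmodType) (f : A -> B) :
  zmod_morphism f -> forall x y, f (x + y) = f x + f y.
Proof.
move=> fB x y; have f0 : f 0 = 0 by rewrite -(subrr 0) fB subrr.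
by rewrite -{1}[y]opprK fB -(sub0r y) fB f0 sub0r opprK.
Qed.

Section TensorMap.
Variables (Gamma : groupType) (P P' : rmod Gamma) (V V' : gmod Gamma).
Variables (f : rmod_hom P P') (g : gmod_hom V V').
Let fg (p : P * V) : P' * V' := (f p.1, g p.2).

Definition tensor_group_map (q : tensor_group P V) : tensor_group P' V' :=
  tensor_pi (freeg_map fg (repr q)).

Lemma freeg_map_relations z :
  z \in @tensor_relations _ P V -> freeg_map fg z \in @tensor_relations _ P' V'.
Proof.
move=> /asboolP; move: z; apply: smallest_sub.
  split=> [|x y hx hy]; first by rewrite raddf0 rpred0.
  by rewrite raddfB rpredB.
have fD := zmod_morphismD (rmh_additive f).
have gD := zmod_morphismD (gmh_additive g).
move=> z h; apply/asboolP; apply: sub_gen_smallest.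
case: h => [[x [y [v ->]]]|[[x [v [w ->]]]|[a [x [v ->]]]]];
  rewrite !raddfB /= !freeg_mapU /fg /=; [left|right; left|right; right].
- by exists (f x), (f y), (g v); rewrite fD.
- by exists (f x), (g v), (g w); rewrite gD.
- by exists a, (f x), (g v); rewrite rmh_act gmh_act.
Qed.

Lemma tensor_group_map_pi z :
  tensor_group_map (tensor_pi z) = tensor_pi (freeg_map fg z).
Proof.
apply: tensor_pi_eq; rewrite -raddfB; apply: freeg_map_relations.
exact: repr_tensor_pi.
Qed.

Lemma tensor_group_map_additive : zmod_morphism tensor_group_map.
Proof.
move=> x y; rewrite -[x]tensor_pi_repr -[y]tensor_pi_repr -tensor_pi_additive.
by rewrite !tensor_group_map_pi raddfB tensor_pi_additive.
Qed.
End TensorMap.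

(* Two additive maps out of a tensor product that agree on the elementary
   tensors are equal. *)
Lemma tensor_ext (Gamma : groupType) (P : rmod Gamma) (V : gmod Gamma) (M : zmodType)
    (a b : tensor_group P V -> M) : zmod_morphism a -> zmod_morphism b ->
  (forall p v, a (tensor_pi << (p, v) >>) = b (tensor_pi << (p, v) >>)) ->
  forall q, a q = b q.
Proof.
move=> ha hb ab q; rewrite -[q]tensor_pi_repr.
apply: (@freeg_ext _ _ (fun z => a (tensor_pi z)) (fun z => b (tensor_pi z))).
- by move=> x y; rewrite tensor_pi_additive ha.
- by move=> x y; rewrite tensor_pi_additive hb.
- by case.
Qed.

Lemma tensor_group_mapU (Gamma : groupType) (P P' : rmod Gamma) (V V' : gmod Gamma)
    (f : rmod_hom P P') (g : gmod_hom V V') p v :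
  tensor_group_map f g (tensor_pi << (p, v) >>) = tensor_pi << (f p, g v) >>.
Proof. by rewrite tensor_group_map_pi freeg_mapU. Qed.

Definition projective (Gamma : groupType) (P : rmod Gamma) : Prop :=
  forall (M N : rmod Gamma) (q : rmod_hom M N) (f : rmod_hom P N),
    (forall y, exists x, q x = y) ->
    exists h : rmod_hom P M, forall x, q (h x) = f x.

(* resolves the trivial right module Z *)
Record projective_resolution (Gamma : groupType) := ProjectiveResolution {
  res :> nat -> rmod Gamma;
  res_d : forall n, rmod_hom (res n.+1) (res n);
  res_aug : res 0%N -> int;
  res_projective : forall n, projective (res n);
  res_aug_additive : zmod_morphism res_aug;
  res_aug_act : forall (g : Gamma) x, res_aug (ract x g) = res_aug x;
  res_aug_surj : forall k, exists x, res_aug x = k;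
  res_exact0 : forall x, res_aug x = 0 <-> exists y, res_d 0 y = x;
  res_exact : forall n x, res_d n x = 0 <-> exists y, res_d n.+1 y = x }.

Section GroupHomology.
Variables (Gamma : groupType) (P : projective_resolution Gamma).

Section Object.
Variable V : gmod Gamma.

Definition tensor_bd n : tensor_group (P n.+1) V -> tensor_group (P n) V :=
  tensor_group_map (res_d P n) (gmod_id V).

Lemma tensor_bd_bd n x : tensor_bd (tensor_bd x : tensor_group (P n.+1) V) = 0.
Proof.
apply: (@tensor_ext _ _ _ _ (fun x => tensor_bd (tensor_bd x)) (fun=> 0)).
- by move=> y z; rewrite /tensor_bd !tensor_group_map_additive.
- by move=> y z; rewrite subr0.
move=> p v; rewrite /tensor_bd !tensor_group_mapU.
have -> : res_d P n (res_d P n.+1 p) = 0 by apply/res_exact; exists p.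
have -> : << (0, v) >> = - (<< (0 + 0, v) >> - << (0, v) >> - << (0, v) >>)
    :> {freeg (P n * V)}.
  by rewrite add0r subrr sub0r opprK.
rewrite -[RHS](subrr (tensor_pi 0)) -tensor_pi_additive subrr.
apply: tensor_pi_eq; rewrite subr0 rpredN.
apply/asboolP; apply: sub_gen_smallest; left.
by exists 0, 0, v.
Qed.

(* The derived tensor product of Z and V over Z[Gamma], computed by P *)
Definition derived_tensor : nat_complex :=
  @NatComplex (fun n => tensor_group (P n) V) tensor_bd
    (fun n => tensor_group_map_additive (res_d P n) (gmod_id V)) tensor_bd_bd.
End Object.

Definition rmod_id (M : rmod Gamma) : rmod_hom M M :=
  @RModHom _ M M id (fun _ _ => erefl) (fun _ _ => erefl).

Section Map.
Variables (V W : gmod Gamma) (f : gmod_hom V W).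

Definition derived_tensor_fun n : derived_tensor V n -> derived_tensor W n :=
  tensor_group_map (rmod_id (P n)) f.

Lemma derived_tensor_additive n : zmod_morphism (@derived_tensor_fun n).
Proof. exact: tensor_group_map_additive. Qed.

Lemma derived_tensor_bd n (x : derived_tensor V n.+1) :
  derived_tensor_fun (bd x) = bd (derived_tensor_fun x).
Proof.
apply: (@tensor_ext _ _ _ _ (fun x => derived_tensor_fun (tensor_bd x))
  (fun x => tensor_bd (derived_tensor_fun x))).
- by move=> y z; rewrite /derived_tensor_fun /tensor_bd !tensor_group_map_additive.
- by move=> y z; rewrite /derived_tensor_fun /tensor_bd !tensor_group_map_additive.
- by move=> p v; rewrite /derived_tensor_fun /tensor_bd !tensor_group_mapU.
Qed.

Definition derived_tensor_map : nat_chain_map (derived_tensor V) (derived_tensor W) :=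
  @NatChainMap (derived_tensor V) (derived_tensor W) derived_tensor_fun
    derived_tensor_additive derived_tensor_bd.
End Map.

Definition DerivedTensor : functor (GMods Gamma) NCh.
Proof.
refine (@Functor (GMods Gamma) NCh derived_tensor derived_tensor_map _ _).
  move=> V; apply: nat_chain_map_eq => n; apply: tensor_ext => //.
    exact: derived_tensor_additive.
  by move=> p v; rewrite /= /derived_tensor_fun tensor_group_mapU.
move=> U V W g f; apply: nat_chain_map_eq => n; apply: tensor_ext.
- exact: derived_tensor_additive.
- by move=> x y; rewrite /= !derived_tensor_additive.
by move=> p v; rewrite /= /derived_tensor_fun !tensor_group_mapU.
Defined.

Definition GroupHomology : functor (GMods Gamma) Spectra :=
  EM \of (extend \of DerivedTensor).
End GroupHomology.

(* Main.v *)
(* An equivariant chain on Gamma x S is supported on tuples with constant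
   S-coordinate, and by local finiteness it is a finite combination of Gamma-orbits
   of such tuples. Hence the coarse complex is isomorphic, naturally in S, to
   Q (x) Z[S] over Z[Gamma], where Q is the homogeneous bar resolution: the
   elementary tensor of basis elements t and s goes to the indicator function of
   the orbit of ((t_0, s), ..., (t_n, s)). By the comparison theorem P and Q are
   homotopy equivalent, and a homotopy equivalence of complexes induces a stable
   equivalence of Eilenberg-MacLane spectra, because the homotopy classes of
   spherical simplices are homology classes. *)
From HB Require Import structures.
From mathcomp Require Import freeg.
From mathcomp Require Import all_boot all_algebra.
From mathcomp Require Import zify.
From mathcomp Require Import boolp classical_sets cardinality.
From Stdlib Require Import Relation_Operators.
Require Import Defs.

Set Implicit Arguments.
Unset Strict Implicit.
Unset Printing Implicit Defensive.

Import GRing.Theory.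
Local Open Scope classical_set_scope.
Local Open Scope ring_scope.

(** * Eilenberg-MacLane spectra *)

(** The equivalence must be strictly natural in S, whereas comparison maps of resolutions are unique
    only up to homotopy. A single comparison from [P] to the bar resolution, fixed before S is
    given, settles this: it acts on the left tensor factor, while S enters through the right one. So
    its composite with the orbit map commutes on the nose with maps of Gamma-sets, and one arrow of
    spectra suffices. The maps back and all homotopies only serve to detect a stable equivalence for
    each S separately.

    Both halves of the isomorphism of complexes rest on Gamma acting freely and transitively on
    itself: every orbit of tuples supporting a chain has exactly one member with first group entry
    1. Evaluation at these members recovers the coefficients, which gives injectivity. The set {1} x
    S is bounded, so the support of a locally finite invariant chain has finitely many orbits, which
    gives surjectivity. *)

Lemma mono_noninj_succ k p (s : mono k.+1 p) : ~ injective s ->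
  exists a : 'I_k.+1, s (lift ord0 a) = s (lift (lift ord0 a) a).
Proof.
move=> si; apply: contrapT => H; apply: si.
(* The two vertices in the statement are a + 1 and a. If neighbours never have equal values,
   monotonicity makes [s] strictly increasing. *)
have step (a b : 'I_k.+2) : (a < b)%N -> s a != s b.
  move=> ab; have bk := ltn_ord b; have ak : (a < k.+1)%N by lia.
  pose a' : 'I_k.+1 := Ordinal ak.
  have aE : lift (lift ord0 a') a' = a by apply: val_inj; rewrite /= /bump; lia.
  have : (s a <= s (lift ord0 a'))%N by apply: mono_homo => /=; rewrite /bump; lia.
  have : (s (lift ord0 a') <= s b)%N by apply: mono_homo => /=; rewrite /bump; lia.
  have : s (lift ord0 a') <> s a by move=> e; apply: H; exists a'; rewrite aE.
  move=> ne h1 h2; apply/eqP => sab; apply: ne; apply: val_inj => /=.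
  by move: h1 h2; rewrite -sab; lia.
move=> a b sab; apply: val_inj; apply: contrapT => /= ne.
have [h|h|//] := ltngtP a b.
  by move: (step _ _ h); rewrite sab eqxx.
by move: (step _ _ h); rewrite sab eqxx.
Qed.

Lemma mono_inj_leq k p (s : mono k p) : injective s -> (k <= p)%N.
Proof. by move=> /leq_card; rewrite !card_ord. Qed.

Lemma mono_inj_id p (s : mono p p) : injective s -> s = mono_id p.
Proof.
move=> si.
have up (i j : 'I_p.+1) : (i < j)%N -> (s i < s j)%N.
  move=> ij; rewrite ltn_neqAle (mono_homo s) ?(ltnW ij) // andbT.
  by apply/eqP => /val_inj/si e; rewrite e ltnn in ij.
have lo n (i : 'I_p.+1) : i = n :> nat -> (n <= s i)%N.
  elim: n i => // n IH i iE.
  have np : (n < p.+1)%N by have := ltn_ord i; lia.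
  apply: leq_ltn_trans (IH (Ordinal np) erefl) _.
  by apply: up; rewrite /= iE.
have hi n (i : 'I_p.+1) : (p - i)%N = n -> (s i <= i)%N.
  elim: n i => [|n IH] i iE; have ip := ltn_ord i; have sip := ltn_ord (s i).
    by lia.
  have np : (i.+1 < p.+1)%N by lia.
  have := IH (Ordinal np); rewrite /= => /(_ ltac:(lia)).
  have := up i (Ordinal np); rewrite /= => /(_ ltac:(lia)).
  by lia.
apply: mono_eq => i; apply: val_inj; apply/eqP; rewrite eqn_leq /=.
by rewrite (hi _ _ erefl) (lo _ _ erefl).
Qed.

(** If [s] takes the same value at a and a + 1, its faces a and a + 1 coincide and carry opposite
    signs, while every other face keeps both vertices and is degenerate. Hence the cycle condition
    on simplices holds by itself where [s] is degenerate. *)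
Lemma alt_sum_degenerate (M : zmodType) k p (y : mono k p -> M) (s : mono k.+1 p) :
  (forall t : mono k p, ~ injective t -> y t = 0) -> ~ injective s ->
  \sum_(i < k.+2) y (mono_comp s (coface i)) *~ (-1) ^+ i = 0.
Proof.
move=> y0 /mono_noninj_succ[a sa].
pose b := lift (lift ord0 a) a.
rewrite (bigD1 b) //= (bigD1 (lift ord0 a)) /=; last first.
  by rewrite -val_eqE /= /bump; lia.
rewrite big1 => [|i /andP[ib ia]]; last first.
  rewrite y0 ?mul0rz // => ti.
  have [u uE] : exists u, lift i u = b.
    by case: (unliftP i b) ib => [u ->|->]; [exists u|rewrite eqxx].
  have [v vE] : exists v, lift i v = lift ord0 a.
    by case: (unliftP i (lift ord0 a)) ia => [v ->|->]; [exists v|rewrite eqxx].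
  have : u = v by apply: ti; rewrite /= uE vE sa.
  by move=> uv; move: uE; rewrite uv vE => /(congr1 val) /=; rewrite /bump; lia.
rewrite addr0.
have -> : mono_comp s (coface (lift ord0 a)) = mono_comp s (coface b).
  apply: mono_eq => j /=; have [->|ja] := eqVneq j a.
    have -> : lift b a = lift ord0 a by apply: val_inj; rewrite /= /bump; lia.
    by rewrite sa.
  congr (s _); apply: val_inj; rewrite /= /bump.
  by move: ja; rewrite -val_eqE /=; lia.
rewrite /= (_ : bump (bump 0 a) a = a); last by rewrite /bump; lia.
by rewrite /bump /= add1n exprS mulN1r mulrNz subrr.
Qed.

Section EMHomotopy.
Variable C : chain_complex.

Lemma em_sphericalP n m (x : em_simplex C n m) :
  @spherical (em_space C n) m x <->
  forall k (s : mono k m), (k < m)%N -> x k s = 0.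
Proof.
split=> [xs k s km|x0 k f km].
  have := congr1 (fun y : em_simplex C n k => y k (mono_id k)) (xs k s km).
  by rewrite /= => <-; congr emc; apply: mono_eq.
apply: em_simplex_eq => l t /=.
have [lm|ml] := ltnP l m; first exact: x0.
by apply: em_degen => /inj_compr /mono_inj_leq; lia.
Qed.

Lemma em_susp_spherical n m (x : em_simplex C n m) :
  @spherical (em_space C n) m x ->
  @spherical (em_space C n.+1) m.+1 (em_susp x).
Proof.
move=> /em_sphericalP xs; apply/em_sphericalP => -[|k] s km //=.
by case: ifP => // _; apply: xs.
Qed.

Lemma em_iter_susp_spherical n m r (x : em_simplex C n m) :
  @spherical (em_space C n) m x ->
  @spherical (em_space C (r + n)) (r + m) (@iter_susp (em_spectrum C) n m r x).
Proof. by move=> xs; elim: r => //= r IH; apply: em_susp_spherical. Qed.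

Lemma dif_mulz i j (x : C i) (z : int) : dif j (x *~ z) = dif j x *~ z.
Proof.
pose d : {additive C i -> C j} :=
  HB.pack (@dif C i j) (GRing.isZmodMorphism.Build _ _ _ (@dif_additive C i j)).
exact: (raddfMz d).
Qed.

(** A spherical simplex vanishes in degrees below m, and normalization makes it vanish on everything
    non-injective, so this one value determines it. It is the cycle that represents the homotopy
    class in homology of degree m - n. *)
Definition em_top n m (x : em_simplex C n m) : C (degsub m n) := x m (mono_id m).

Lemma em_top_cycle n m (x : em_simplex C n m) :
  @spherical (em_space C n) m x -> forall j, dif j (em_top x) = 0.
Proof.
rewrite /em_top; case: m x => [|m] x xs j; first exact: em_dif0.
have [jE|jE] := eqVneq j (degsub m n); last first.
  apply: dif_shape; apply: contraNneq jE; rewrite !degsubE => jE.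
  by apply/eqP; move: jE; rewrite intS; lia.
rewrite jE.
have : dif (degsub m n) (x m.+1 (mono_id m.+1)) *~ (-1) ^+ n *~ (-1) ^+ n = 0.
  rewrite em_dif big1 ?mul0rz // => i _.
  by rewrite (em_sphericalP x).1 // mul0rz.
by rewrite -mulrzA -exprD addnn -mul2n exprM sqrrN !expr1n mulr1z.
Qed.

Lemma em_homotopic_boundary n m (x y : em_simplex C n m) :
  @homotopic (em_space C n) m x y ->
  exists w : C (degsub m.+1 n), dif (degsub m n) w = em_top x - em_top y.
Proof.
(* Only the faces m and m + 1 of [h] contribute, with signs (-1)^m and (-1)^(m+1). The remaining
   (-1)^n is that of the differential of the shifted complex. *)
move=> [h hE]; exists (h m.+1 (mono_id m.+1) *~ (-1) ^+ (n + m)).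
have hv (i : 'I_m.+2) : h m (mono_comp (mono_id m.+1) (coface i)) =
    emc (if i == m :> nat then x else if i == m.+1 :> nat then y else em_zero C n m)
      (mono_id m).
  have -> : mono_comp (mono_id m.+1) (coface i) = mono_comp (coface i) (mono_id m).
    exact: mono_eq.
  exact: (congr1 (fun z : em_simplex C n m => z m (mono_id m)) (hE i)).
rewrite dif_mulz exprD mulrzA em_dif 2!big_ord_recr /= big1 => [|i _]; last first.
  rewrite hv /=; have := ltn_ord i => im.
  by rewrite !ifN ?mul0rz //; apply/eqP; lia.
rewrite add0r !hv /= eqxx ifN ?eqxx; last by apply/eqP; lia.
rewrite exprS mulN1r mulrNz -mulrzBl -mulrzA -exprD addnn -mul2n exprM.
by rewrite sqrrN !expr1n mulr1z.
Qed.

Section FillHomotopy.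
Variables (n m : nat) (x y : em_simplex C n m) (w : C (degsub m.+1 n)).
Hypotheses (xs : @spherical (em_space C n) m x) (ys : @spherical (em_space C n) m y).
Hypothesis dw : dif (degsub m n) w = em_top x - em_top y.

(** Transport along an equality of degrees, extended by zero to distinct degrees. It lets a single
    formula prescribe the values of a simplex in all degrees at once. *)
Definition deg_cast k l (a : C (degsub k n)) : C (degsub l n) :=
  if k =P l is ReflectT e then eq_rect k (fun i => C (degsub i n) : Type) a l e else 0.

Lemma deg_cast_id k (a : C (degsub k n)) : deg_cast k a = a.
Proof. by rewrite /deg_cast; case: eqP => // e; rewrite (eq_axiomK e). Qed.

Lemma deg_cast0 k l (a : C (degsub k n)) : k <> l -> deg_cast l a = 0.
Proof. by rewrite /deg_cast; case: eqP. Qed.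

(* fill_val is the (m+1)-simplex with top value w, up to sign, whose faces m and
   m+1 are x and y and whose other faces vanish: an injective [m] -> [m+1] is a
   coface, recognized by the vertex that it omits. *)
Definition fill_face k (s : mono k m.+1) : C (degsub m n) :=
  if s ord_max != ord_max then em_top y
  else if [forall j, s j != m :> nat] then em_top x else 0.

Definition fill_val k (s : mono k m.+1) : C (degsub k n) :=
  if `[< injective s >] then
    deg_cast k (w *~ (-1) ^+ (n + m)) + deg_cast k (fill_face s)
  else 0.

Lemma fill_degen k (s : mono k m.+1) : ~ injective s -> fill_val s = 0.
Proof. by move=> si; rewrite /fill_val asboolF. Qed.

Lemma fill_face_cycle k (s : mono k m.+1) l j : dif j (deg_cast l (fill_face s)) = 0.
Proof.
have [<-|ml] := eqVneq m l; last by rewrite deg_cast0 ?dif0 //; apply/eqP.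
rewrite deg_cast_id /fill_face.
by case: ifP => _; [|case: ifP => _]; rewrite ?em_top_cycle ?dif0.
Qed.

Lemma fill_dif0 (s : mono 0 m.+1) j : dif j (fill_val s) = 0.
Proof.
rewrite /fill_val; case: ifP => _; last exact: dif0.
by rewrite deg_cast0 // add0r fill_face_cycle.
Qed.

Lemma fill_coface (i : 'I_m.+2) : fill_val (coface i) =
  em_top (if i == m :> nat then x else if i == m.+1 :> nat then y else em_zero C n m).
Proof.
rewrite /fill_val asboolT; last exact: lift_inj.
rewrite deg_cast0 ?add0r ?deg_cast_id; last by lia.
rewrite /fill_face.
have im := ltn_ord i.
have -> : (coface i ord_max != ord_max) = (i == m.+1 :> nat).
  by rewrite -val_eqE /= /bump; lia.
have -> : [forall j, coface i j != m :> nat] = (i == m :> nat).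
  apply/forallP/eqP => [H|iE j]; last by rewrite /= /bump; lia.
  have [il|il|//] := ltngtP i m.
    have mp : (m.-1 < m.+1)%N by lia.
    by have := H (Ordinal mp); rewrite /= /bump; lia.
  by have := H ord_max; rewrite /= /bump; lia.
by case: ifP => [/eqP ->|_]; [rewrite ifN //; apply/eqP; lia|case: ifP].
Qed.

Lemma fill_dif k (s : mono k.+1 m.+1) :
  dif (degsub k n) (fill_val s) *~ (-1) ^+ n =
  \sum_(i < k.+2) fill_val (mono_comp s (coface i)) *~ (-1) ^+ i.
Proof.
have [si|si] := pselect (injective s); last first.
  by rewrite fill_degen // dif0 mul0rz alt_sum_degenerate //; apply: fill_degen.
have := mono_inj_leq si; rewrite ltnS leq_eqVlt => /orP[/eqP km|km]; last first.
  (* Here [s] has dimension at most m, so its value is 0 or a cycle, and its faces have dimension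
     below m, where all values are 0. *)
  rewrite big1 => [|i _]; last first.
    rewrite /fill_val; case: ifP => _; last by rewrite mul0rz.
    by rewrite !deg_cast0 ?addr0 ?mul0rz //; lia.
  rewrite /fill_val asboolT // deg_cast0; last by lia.
  by rewrite add0r fill_face_cycle mul0rz.
subst k; rewrite (mono_inj_id si).
under eq_bigr => i _.
  rewrite (_ : mono_comp _ _ = coface i); last exact: mono_eq.
  rewrite fill_coface; over.
rewrite 2!big_ord_recr /= big1 => [|i _]; last first.
  by have := ltn_ord i => im; rewrite !ifN ?mul0rz //; apply/eqP; lia.
rewrite add0r eqxx ifN ?eqxx; last by apply/eqP; lia.
rewrite exprS mulN1r mulrNz -mulrzBl.
rewrite /fill_val asboolT //= deg_cast_id [X in _ + X]deg_cast0 ?addr0; last by lia.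
rewrite dif_mulz dw -mulrzA -exprD addnAC exprD addnn -mul2n exprM.
by rewrite sqrrN !expr1n mul1r.
Qed.

Lemma em_boundary_homotopic : @homotopic (em_space C n) m x y.
Proof.
exists (EMSimplex fill_degen fill_dif0 fill_dif) => i.
apply: em_simplex_eq => k s /=.
set z := if _ then x else _.
have zs : @spherical (em_space C n) m z.
  by rewrite /z; case: ifP => // _; case: ifP => // _; apply/em_sphericalP.
have [si|si] := pselect (injective s); last first.
  by rewrite em_degen // fill_degen // => /inj_compr.
have := mono_inj_leq si; rewrite leq_eqVlt => /orP[/eqP km|km].
  subst k; rewrite (mono_inj_id si) (_ : mono_comp _ _ = coface i); last exact: mono_eq.
  by rewrite fill_coface.
rewrite (em_sphericalP z).1 //.
by rewrite /fill_val; case: ifP => _ //; rewrite !deg_cast0 ?addr0 //; lia.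
Qed.
End FillHomotopy.
End EMHomotopy.

(** The map induced on homology is the identity. The upper degree is a variable [j] with an
    equation, so that [degsub m.+1 n] can be substituted without transporting chains. *)
Definition homology_identity (C : chain_complex) (f : chain_map C C) : Prop :=
  forall i j (x : C i), j = i + 1 -> (forall k, dif k x = 0) ->
    exists w : C j, dif i w = f i x - x.

Lemma em_homology_identity (C : chain_complex) (f : chain_map C C) n m
    (x : em_simplex C n m) : homology_identity f ->
  @spherical (em_space C n) m x ->
  exists w : C (degsub m.+1 n), dif (degsub m n) w = f _ (em_top x) - em_top x.
Proof.
move=> fi xs; apply: fi; last exact: em_top_cycle.
by rewrite !degsubE intS; lia.
Qed.

Lemma em_map_iter_susp (C D : chain_complex) (f : chain_map C D) n m r
    (x : em_simplex C n m) :
  em_map f _ _ (@iter_susp (em_spectrum C) n m r x) =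
  @iter_susp (em_spectrum D) n m r (em_map f _ _ x).
Proof. by elim: r => //= r IH; rewrite -IH em_map_susp. Qed.

Lemma em_map_spherical (C D : chain_complex) (f : chain_map C D) n m
    (x : em_simplex C n m) :
  @spherical (em_space C n) m x -> @spherical (em_space D n) m (em_map_simplex f x).
Proof.
by move=> /em_sphericalP xs; apply/em_sphericalP => k s km /=; rewrite xs // chm0.
Qed.

(** For spherical simplices, being homotopic means that the top values are homologous, at every
    level of the spectrum. So the injectivity half keeps the given number of suspensions, and the
    surjectivity half uses none. *)
Lemma em_map_stable_equivalence (C D : chain_complex)
    (f : chain_map C D) (g : chain_map D C) :
  homology_identity (chain_comp g f) -> homology_identity (chain_comp f g) ->
  stable_equivalence (em_map f).
Proof.
move=> gf fg; split=> [n m x x' xs xs' [r]|n m y ys].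
  rewrite -!em_map_iter_susp => /em_homotopic_boundary[w wE]; exists r.
  have zs := em_iter_susp_spherical (r := r) xs.
  have zs' := em_iter_susp_spherical (r := r) xs'.
  move: (iter_susp r x) (iter_susp r x') zs zs' wE => z z' zs zs' wE.
  have [u uE] := em_homology_identity gf zs.
  have [u' uE'] := em_homology_identity gf zs'.
  (* On top values, dw = f z - f z', du = g f z - z and du' = g f z' - z', hence d (g w - (u - u'))
     = z - z'. *)
  apply: (em_boundary_homotopic (w := g _ w - (u - u'))) => //.
  rewrite !difB uE uE' -chm_dif wE /= chmB /em_top /=.
  set a := g _ _; set a' := g _ _; set b := emc z _; set b' := emc z' _.
  by apply/eqP; rewrite subr_eq (opprB a') addrACA (addrC b) subrK addKr.
exists 0%N, (em_map_simplex g y); first exact: em_map_spherical.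
have [w wE] := em_homology_identity fg ys.
by apply: (em_boundary_homotopic (w := w)) => //; do 2 apply: em_map_spherical.
Qed.

(** * Homotopy equivalences of complexes *)

Definition homotopic_to_id (C : nat_complex) (e : nat_chain_map C C) : Prop :=
  exists h : forall n, C n -> C n.+1,
    [/\ forall n, zmod_morphism (h n),
        forall x, e 0%N x - x = bd (h 0%N x) &
        forall n x, e n.+1 x - x = bd (h n.+1 x) + h n (bd x)].

Lemma zmod_morphism0 (A B : zmodType) (f : A -> B) : zmod_morphism f -> f 0 = 0.
Proof. by move=> fB; rewrite -(subrr 0) fB subrr. Qed.

Lemma ext_homology_identity (C : nat_complex) (e : nat_chain_map C C) :
  homotopic_to_id e -> homology_identity (ext_map e).
Proof.
(* In negative degrees the group consists of row vectors of length 0, where any two elements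
   agree. *)
move=> [h [hB h0 hS]] [n|n] j x jE xc; last by exists 0; apply/matrixP => i [].
have {}jE : j = n.+1 by rewrite jE -PoszD addn1.
subst j; case: n x xc => [|n] x xc.
  by exists (h 0%N x); rewrite [LHS]ext_dif_succ -h0.
exists (h n.+1 x); rewrite [LHS]ext_dif_succ [RHS]hS.
have := xc n; rewrite [LHS]ext_dif_succ => ->.
by rewrite (zmod_morphism0 (hB n)) addr0.
Qed.

Lemma ext_map_comp (C D E : nat_complex) (g : nat_chain_map D E) (f : nat_chain_map C D) :
  chain_comp (ext_map g) (ext_map f) = ext_map (nat_chain_comp g f).
Proof. by apply: chain_map_eq => -[n|n] x. Qed.

Lemma em_ext_stable_equivalence (C D : nat_complex)
    (f : nat_chain_map C D) (g : nat_chain_map D C) :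
  homotopic_to_id (nat_chain_comp g f) -> homotopic_to_id (nat_chain_comp f g) ->
  stable_equivalence (em_map (ext_map f)).
Proof.
move=> gf fg; apply: (@em_map_stable_equivalence _ _ _ (ext_map g));
  by rewrite ext_map_comp; apply: ext_homology_identity.
Qed.

(** * The comparison theorem *)

Section RightModules.
Variable Gamma : groupType.
Implicit Types L M N : rmod Gamma.

Lemma rmod_comp_additive L M N (g : rmod_hom M N) (f : rmod_hom L M) :
  zmod_morphism (fun x => g (f x)).
Proof. by move=> x y; rewrite !rmh_additive. Qed.

Lemma rmod_comp_act L M N (g : rmod_hom M N) (f : rmod_hom L M) a x :
  g (f (ract x a)) = ract (g (f x)) a.
Proof. by rewrite !rmh_act. Qed.

Definition rmod_comp L M N (g : rmod_hom M N) (f : rmod_hom L M) : rmod_hom L N :=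
  RModHom (rmod_comp_additive g f) (rmod_comp_act g f).

Lemma rmod_sub_additive M N (f g : rmod_hom M N) : zmod_morphism (fun x => f x - g x).
Proof. by move=> x y; rewrite !rmh_additive opprD addrACA -opprD. Qed.

Lemma rmod_sub_act M N (f g : rmod_hom M N) a x :
  f (ract x a) - g (ract x a) = ract (f x - g x) a.
Proof. by rewrite !rmh_act ract_additive. Qed.

Definition rmod_sub M N (f g : rmod_hom M N) : rmod_hom M N :=
  RModHom (rmod_sub_additive f g) (rmod_sub_act f g).

Section Image.
Variables (M N : rmod Gamma) (d : rmod_hom M N).

Definition image_pred : {pred N} := fun y => `[< exists x, d x = y >].

Lemma image_closed : zmod_closed image_pred.
Proof.
split=> [|_ _ /asboolP[x <-] /asboolP[y <-]]; apply/asboolP.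
  by exists 0; apply: zmod_morphism0; apply: rmh_additive.
by exists (x - y); rewrite rmh_additive.
Qed.

HB.instance Definition _ := GRing.isZmodClosed.Build N image_pred image_closed.

Record image_type := ImageType { image_val :> N; image_mem : image_val \in image_pred }.

HB.instance Definition _ := [isSub for image_val].
HB.instance Definition _ := [Choice of image_type by <:].
HB.instance Definition _ := [SubChoice_isSubZmodule of image_type by <:].

Lemma image_ract_mem (y : image_type) g : ract (y : N) g \in image_pred.
Proof.
case: y => _ /= /asboolP[x <-].
by apply/asboolP; exists (ract x g); rewrite rmh_act.
Qed.

Definition image_ract (y : image_type) g : image_type := ImageType (image_ract_mem y g).

Definition image_rmod : rmod Gamma.
Proof.
refine (@RMod Gamma image_type image_ract _ _ _).
- by move=> g x y; apply: val_inj; rewrite /= ract_additive.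
- by move=> x; apply: val_inj; rewrite /= ract1.
- by move=> g h x; apply: val_inj; rewrite /= ractM.
Defined.
End Image.

(* Projectivity is tested on the surjection onto the image of d. *)
Lemma projective_lift (P M N : rmod Gamma) (d : rmod_hom M N) (f : rmod_hom P N) :
  projective P -> (forall x, exists y, d y = f x) ->
  exists h : rmod_hom P M, forall x, d (h x) = f x.
Proof.
move=> Pproj fd.
have fm x : f x \in image_pred d by apply/asboolP.
have dm x : d x \in image_pred d by apply/asboolP; exists x.
have fB : zmod_morphism (fun x => ImageType (fm x) : image_rmod d).
  by move=> x y; apply: val_inj; rewrite /= rmh_additive.
have fG g x : ImageType (fm (ract x g)) = ract (ImageType (fm x) : image_rmod d) g.
  by apply: val_inj; rewrite /= rmh_act.
have dB : zmod_morphism (fun x => ImageType (dm x) : image_rmod d).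
  by move=> x y; apply: val_inj; rewrite /= rmh_additive.
have dG g x : ImageType (dm (ract x g)) = ract (ImageType (dm x) : image_rmod d) g.
  by apply: val_inj; rewrite /= rmh_act.
have [|h hE] := Pproj M (image_rmod d) (RModHom dB dG) (RModHom fB fG).
  case=> y ym; have /asboolP[x xy] := ym.
  by exists x; apply: val_inj.
by exists h => x; have := congr1 val (hE x).
Qed.
End RightModules.

(** Dependent choice for families. Comparison maps and homotopies are built degree by degree, each
    constrained by its predecessor through [R]; [good] is the invariant that allows the next
    choice. *)
Lemma dependent_sequence (T : nat -> Type) (good : forall n, T n -> Prop)
    (R : forall n, T n -> T n.+1 -> Prop) (t0 : T 0%N) : good 0%N t0 ->
  (forall n t, good n t -> exists2 t', R n t t' & good n.+1 t') ->
  exists s : forall n, T n, s 0%N = t0 /\ forall n, R n (s n) (s n.+1).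
Proof.
move=> g0 step.
pose next n (t : {t | good n t}) : {t' : {t' | good n.+1 t'} | R n (sval t) (sval t')} :=
  let: exist2 t' h h' := cid2 (step n (sval t) (svalP t)) in exist _ (exist _ t' h') h.
pose s := nat_rect (fun n => {t | good n t}) (exist _ t0 g0)
  (fun n t => sval (next n t)).
exists (fun n => sval (s n)); split=> // n.
exact: svalP (next n (s n)).
Qed.

Record comparison (Gamma : groupType) (P Q : projective_resolution Gamma) := Comparison {
  cmp :> forall n, rmod_hom (P n) (Q n);
  cmp_d : forall n x, res_d Q n (cmp n.+1 x) = cmp n (res_d P n x);
  cmp_aug : forall x, res_aug (cmp 0%N x) = res_aug x }.

Section Comparison.
Variable Gamma : groupType.
Implicit Types P Q : projective_resolution Gamma.

Lemma res_dd P n x : res_d P n (res_d P n.+1 x) = 0.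
Proof. by apply/res_exact; exists x. Qed.

Lemma res_aug_d P x : res_aug (res_d P 0 x) = 0.
Proof. by apply/res_exact0; exists x. Qed.

Definition trivial_rmod : rmod Gamma :=
  @RMod Gamma int (fun x _ => x) (fun _ _ _ => erefl) (fun _ => erefl)
    (fun _ _ _ => erefl).

Definition aug_hom P : rmod_hom (P 0%N) trivial_rmod :=
  @RModHom _ (P 0%N) trivial_rmod (@res_aug _ P) (@res_aug_additive _ P)
    (@res_aug_act _ P).

Lemma comparison_exists P Q : inhabited (comparison P Q).
Proof.
have [f0 f0E] : exists h : rmod_hom (P 0%N) (Q 0%N), forall x, aug_hom Q (h x) = aug_hom P x.
  apply: projective_lift; first exact: res_projective.
  by move=> x; apply: res_aug_surj.
(* [good] is the hypothesis of [projective_lift] for f d. It passes to the next degree because d f'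
   d = f d d = 0 and [Q] is exact. *)
pose good n (f : rmod_hom (P n) (Q n)) :=
  forall x, exists y, res_d Q n y = f (res_d P n x).
pose R n (f : rmod_hom (P n) (Q n)) (f' : rmod_hom (P n.+1) (Q n.+1)) :=
  forall x, res_d Q n (f' x) = f (res_d P n x).
have [|n f fg|s [s0 sR]] := @dependent_sequence _ good R f0.
- by move=> x; apply/res_exact0; rewrite [LHS]f0E [LHS]res_aug_d.
- have [h hE] := @projective_lift _ _ _ _ (res_d Q n) (rmod_comp f (res_d P n))
    (@res_projective _ P n.+1) fg.
  exists h => // x; apply/res_exact.
  by rewrite [LHS]hE /= res_dd zmod_morphism0 //; apply: rmh_additive.
by split; apply: (@Comparison _ P Q s) => // x; rewrite s0; apply: f0E.
Qed.

(** A chain map over the zero map of the integers is null-homotopic: in each degree e - h d is a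
    cycle, hence a boundary, and projectivity lifts it. The input is a bare family of homomorphisms
    because the lemma is applied to a difference of comparisons, which kills the augmentation
    instead of preserving it. *)
Lemma comparison_null P Q (e : forall n, rmod_hom (P n) (Q n)) :
  (forall n x, res_d Q n (e n.+1 x) = e n (res_d P n x)) ->
  (forall x, res_aug (e 0%N x) = 0) ->
  exists h : forall n, rmod_hom (P n) (Q n.+1),
    (forall x, e 0%N x = res_d Q 0 (h 0%N x)) /\
    forall n x, e n.+1 x = res_d Q n.+1 (h n.+1 x) + h n (res_d P n x).
Proof.
move=> ed e0.
have [h0 h0E] := @projective_lift _ _ _ _ (res_d Q 0) (e 0%N) (@res_projective _ P 0%N)
  (fun x => (res_exact0 (e 0%N x)).1 (e0 x)).
pose good n (h : rmod_hom (P n) (Q n.+1)) :=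
  forall x, exists y, res_d Q n.+1 y = e n.+1 x - h (res_d P n x).
pose R n (h : rmod_hom (P n) (Q n.+1)) (h' : rmod_hom (P n.+1) (Q n.+2)) :=
  forall x, e n.+1 x = res_d Q n.+1 (h' x) + h (res_d P n x).
have [|n h hg|s [s0 sR]] := @dependent_sequence _ good R h0.
- by move=> x; apply/res_exact; rewrite rmh_additive ed h0E subrr.
- have [h' hE] := @projective_lift _ _ _ _ (res_d Q n.+1)
    (rmod_sub (e n.+1) (rmod_comp h (res_d P n))) (@res_projective _ P n.+1) hg.
  exists h' => x; first by rewrite hE /= subrK.
  apply/res_exact; rewrite rmh_additive ed hE /= res_dd.
  by rewrite [X in _ - (_ - X)]zmod_morphism0 ?subr0 ?subrr //; apply: rmh_additive.
by exists s; split=> // x; rewrite s0.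
Qed.

Lemma comparison_homotopy P (e : comparison P P) :
  exists h : forall n, rmod_hom (P n) (P n.+1),
    (forall x, e 0%N x - x = res_d P 0 (h 0%N x)) /\
    forall n x, e n.+1 x - x = res_d P n.+1 (h n.+1 x) + h n (res_d P n x).
Proof.
apply: (@comparison_null P P (fun n => rmod_sub (e n) (rmod_id (P n)))) => [n x|x] /=.
  by rewrite rmh_additive cmp_d.
by rewrite res_aug_additive cmp_aug subrr.
Qed.

Lemma comp_comparison_d P Q (g : comparison Q P) (f : comparison P Q) n x :
  res_d P n (rmod_comp (g n.+1) (f n.+1) x) = rmod_comp (g n) (f n) (res_d P n x).
Proof. by rewrite /= !cmp_d. Qed.

Lemma comp_comparison_aug P Q (g : comparison Q P) (f : comparison P Q) x :
  res_aug (rmod_comp (g 0%N) (f 0%N) x) = res_aug x.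
Proof. by rewrite /= !cmp_aug. Qed.

Definition comp_comparison P Q (g : comparison Q P) (f : comparison P Q) :
    comparison P P :=
  Comparison (comp_comparison_d g f) (comp_comparison_aug g f).
End Comparison.

(** * Comparison maps after tensoring *)

Section TensorComparison.
Variables (Gamma : groupType) (V : gmod Gamma).
Implicit Types P Q : projective_resolution Gamma.

Lemma tensor_piDl (P : rmod Gamma) (x y : P) (v : V) :
  tensor_pi << (x + y, v) >> = tensor_pi << (x, v) >> + tensor_pi << (y, v) >>.
Proof.
rewrite -(zmod_morphismD (@tensor_pi_additive _ P V)); apply: tensor_pi_eq.
rewrite opprD addrA; apply/asboolP; apply: sub_gen_smallest; left.
by exists x, y, v.
Qed.

Lemma tensor_piDr (P : rmod Gamma) (x : P) (v w : V) :
  tensor_pi << (x, v + w) >> = tensor_pi << (x, v) >> + tensor_pi << (x, w) >>.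
Proof.
rewrite -(zmod_morphismD (@tensor_pi_additive _ P V)); apply: tensor_pi_eq.
rewrite opprD addrA; apply/asboolP; apply: sub_gen_smallest; right; left.
by exists x, v, w.
Qed.

Lemma tensor_pi_ract (P : rmod Gamma) (x : P) (v : V) g :
  tensor_pi << (ract x g, v) >> = tensor_pi << (x, lact g v) >>.
Proof.
apply: tensor_pi_eq; apply/asboolP; apply: sub_gen_smallest; right; right.
by exists g, x, v.
Qed.

Lemma tensor_piBl (P : rmod Gamma) (x y : P) (v : V) :
  tensor_pi << (x - y, v) >> = tensor_pi << (x, v) >> - tensor_pi << (y, v) >>.
Proof. by apply/eqP; rewrite eq_sym subr_eq -tensor_piDl subrK. Qed.

Lemma tensor_piBr (P : rmod Gamma) (x : P) (v w : V) :
  tensor_pi << (x, v - w) >> = tensor_pi << (x, v) >> - tensor_pi << (x, w) >>.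
Proof. by apply/eqP; rewrite eq_sym subr_eq -tensor_piDr subrK. Qed.

Section Map.
Variables (P Q : projective_resolution Gamma) (f : comparison P Q).

Definition derived_change_fun n : derived_tensor P V n -> derived_tensor Q V n :=
  tensor_group_map (f n) (gmod_id V).

Lemma derived_change_additive n : zmod_morphism (@derived_change_fun n).
Proof. exact: tensor_group_map_additive. Qed.

Lemma derived_change_bd n (x : derived_tensor P V n.+1) :
  derived_change_fun (bd x) = bd (derived_change_fun x).
Proof.
apply: (@tensor_ext _ _ _ _ (fun x => derived_change_fun (tensor_bd x))
  (fun x => tensor_bd (derived_change_fun x))).
- by move=> y z; rewrite /derived_change_fun /tensor_bd !tensor_group_map_additive.
- by move=> y z; rewrite /derived_change_fun /tensor_bd !tensor_group_map_additive.
- by move=> p v; rewrite /derived_change_fun /tensor_bd !tensor_group_mapU cmp_d.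
Qed.

Definition derived_change : nat_chain_map (derived_tensor P V) (derived_tensor Q V) :=
  NatChainMap derived_change_additive derived_change_bd.
End Map.

Lemma derived_change_homotopic P Q (g : comparison Q P) (f : comparison P Q) :
  homotopic_to_id (nat_chain_comp (derived_change g) (derived_change f)).
Proof.
have [h [h0 hS]] := comparison_homotopy (comp_comparison g f).
pose H n : derived_tensor P V n -> derived_tensor P V n.+1 :=
  tensor_group_map (h n) (gmod_id V).
have HB n : zmod_morphism (H n) by apply: tensor_group_map_additive.
exists H; split=> //.
- apply: (@tensor_ext _ _ _ _ (fun x => derived_change_fun g (derived_change_fun f x) - x)
    (fun x => tensor_bd (H 0%N x))).
  + by move=> x y; rewrite !derived_change_additive opprD addrACA -opprD.
  + by move=> x y; rewrite HB /tensor_bd tensor_group_map_additive.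
  + move=> p v; rewrite /derived_change_fun /H /tensor_bd !tensor_group_mapU /=.
    by rewrite -tensor_piBl -h0.
- move=> n; apply: (@tensor_ext _ _ _ _
    (fun x => derived_change_fun g (derived_change_fun f x) - x)
    (fun x => tensor_bd (H n.+1 x) + H n (tensor_bd x))).
  + by move=> x y; rewrite !derived_change_additive opprD addrACA -opprD.
  + move=> x y; rewrite HB /tensor_bd !tensor_group_map_additive HB.
    by rewrite opprD addrACA.
  + move=> p v; rewrite /derived_change_fun /H /tensor_bd !tensor_group_mapU /=.
    by rewrite -tensor_piBl -tensor_piDl -hS.
Qed.
End TensorComparison.

Lemma derived_change_natural (Gamma : groupType) (V W : gmod Gamma)
    (P Q : projective_resolution Gamma) (f : comparison P Q) (a : gmod_hom V W) n
    (x : derived_tensor P V n) :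
  derived_change W f n (derived_tensor_map P a n x) =
  derived_tensor_map Q a n (derived_change V f n x).
Proof.
apply: (@tensor_ext _ _ _ _ (fun x => derived_change_fun f (derived_tensor_fun a x))
  (fun x => derived_tensor_fun a (derived_change_fun f x))).
- by move=> y z; rewrite derived_tensor_additive derived_change_additive.
- by move=> y z; rewrite derived_change_additive derived_tensor_additive.
- by move=> p v; rewrite /derived_change_fun /derived_tensor_fun !tensor_group_mapU.
Qed.

(** * The bar resolution *)

(** The universal property of the free abelian group; [ssrint.zmodule M] regards [M] as a module
    over the integers, as [fglift] expects. *)
Definition freeg_lift (S : choiceType) (M : zmodType) (f : S -> M) : {freeg S} -> M :=
  fglift (f : S -> ssrint.zmodule M).

Lemma freeg_lift_additive (S : choiceType) (M : zmodType) (f : S -> M) :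
  zmod_morphism (freeg_lift f).
Proof. exact: (@lift_is_additive _ S (ssrint.zmodule M) f). Qed.

Lemma freeg_liftU (S : choiceType) (M : zmodType) (f : S -> M) s :
  freeg_lift f << s >> = f s.
Proof. by rewrite /freeg_lift liftU scale1r. Qed.

Lemma zmod_morphism_comp (A B D : zmodType) (g : B -> D) (f : A -> B) :
  zmod_morphism g -> zmod_morphism f -> zmod_morphism (fun x => g (f x)).
Proof. by move=> gB fB x y; rewrite fB gB. Qed.

Lemma zmod_morphismMz (A B : zmodType) (f : A -> B) :
  zmod_morphism f -> forall x z, f (x *~ z) = f x *~ z.
Proof.
move=> fB; pose F : {additive A -> B} := HB.pack f (GRing.isZmodMorphism.Build _ _ f fB).
by move=> x z; apply: (raddfMz F).
Qed.

Lemma zmod_morphism_sum (A B : zmodType) (f : A -> B) : zmod_morphism f ->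
  forall (I : Type) (r : seq I) (P : pred I) (F : I -> A),
    f (\sum_(i <- r | P i) F i) = \sum_(i <- r | P i) f (F i).
Proof.
move=> fB; pose F : {additive A -> B} := HB.pack f (GRing.isZmodMorphism.Build _ _ f fB).
exact: (raddf_sum F).
Qed.

Section BarResolution.
Variable Gamma : groupType.

Definition bar_tuple n := {ffun 'I_n.+1 -> Gamma}.

(** The diagonal left translation, inverted into a right action so that tuples span right
    modules. *)
Definition bar_tact n (g : Gamma) (t : bar_tuple n) : bar_tuple n :=
  [ffun i => g^-1 * t i]%g.

Lemma bar_tact1 n (t : bar_tuple n) : bar_tact 1%g t = t.
Proof. by apply/ffunP => i; rewrite ffunE invg1 mul1g. Qed.

Lemma bar_tactM n g h (t : bar_tuple n) : bar_tact (g * h)%g t = bar_tact h (bar_tact g t).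
Proof. by apply/ffunP => i; rewrite !ffunE invgM mulgA. Qed.

Definition bar_face n (i : 'I_n.+2) (t : bar_tuple n.+1) : bar_tuple n :=
  [ffun j => t (lift i j)].

Definition bar_cone n (t : bar_tuple n) : bar_tuple n.+1 :=
  [ffun i => if unlift ord0 i is Some j then t j else 1%g].

Lemma bar_tact_face n (i : 'I_n.+2) g (t : bar_tuple n.+1) :
  bar_face i (bar_tact g t) = bar_tact g (bar_face i t).
Proof. by apply/ffunP => j; rewrite !ffunE. Qed.

Lemma bar_face0_cone n (t : bar_tuple n) : bar_face ord0 (bar_cone t) = t.
Proof. by apply/ffunP => j; rewrite !ffunE liftK. Qed.

Lemma bar_faceS_cone n (i : 'I_n.+2) (t : bar_tuple n.+1) :
  bar_face (lift ord0 i) (bar_cone t) = bar_cone (bar_face i t).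
Proof.
apply/ffunP => j; rewrite !ffunE; case: (unliftP ord0 j) => [k|] ->.
  by rewrite coface_lift0 liftK ffunE.
by rewrite coface_ord0 unlift_none.
Qed.

Lemma bar_tuple_cone n (t : bar_tuple n.+1) :
  t = bar_tact (t ord0)^-1%g (bar_cone (bar_face ord0 (bar_tact (t ord0) t))).
Proof.
apply/ffunP => i; rewrite !ffunE invgK; case: (unliftP ord0 i) => [j|] ->.
  by rewrite !ffunE mulVKg.
by rewrite mulg1.
Qed.

Definition bar_module (n : nat) : rmod Gamma.
Proof.
refine (@RMod Gamma {freeg (bar_tuple n)} (fun z g => freeg_map (bar_tact g) z) _ _ _).
- by move=> g; apply: freeg_map_additive.
- move=> z; rewrite -[RHS]freeg_map_id; congr (freeg_map _ z).
  by apply: funext => t; apply: bar_tact1.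
- move=> g h z; rewrite -freeg_map_comp; congr (freeg_map _ z).
  by apply: funext => t; apply: bar_tactM.
Defined.

Lemma bar_ext n (M : zmodType) (f g : bar_module n -> M) :
  zmod_morphism f -> zmod_morphism g -> (forall t, f << t >> = g << t >>) ->
  forall x, f x = g x.
Proof. exact: freeg_ext. Qed.

Lemma bar_ractU n (t : bar_tuple n) g :
  ract (<< t >> : bar_module n) g = << bar_tact g t >>.
Proof. exact: freeg_mapU. Qed.

Definition bar_d_fun n (z : bar_module n.+1) : bar_module n :=
  \sum_(i < n.+2) freeg_map (bar_face i) z *~ (-1) ^+ i.

Lemma bar_d_additive n : zmod_morphism (@bar_d_fun n).
Proof.
move=> x y; rewrite /bar_d_fun -sumrB; apply: eq_bigr => i _.
by rewrite raddfB mulrzBl.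
Qed.

Lemma bar_dU n (t : bar_tuple n.+1) :
  bar_d_fun << t >> = \sum_(i < n.+2) << bar_face i t >> *~ (-1) ^+ i.
Proof. by apply: eq_bigr => i _; rewrite freeg_mapU. Qed.

Lemma bar_d_act n g (x : bar_module n.+1) :
  bar_d_fun (ract x g) = ract (bar_d_fun x) g.
Proof.
rewrite /bar_d_fun (zmod_morphism_sum (ract_additive g)); apply: eq_bigr => i _.
rewrite (zmod_morphismMz (ract_additive g)) /= -!freeg_map_comp.
by congr (freeg_map _ x *~ _); apply: funext => t; apply: bar_tact_face.
Qed.

Definition bar_d n : rmod_hom (bar_module n.+1) (bar_module n) :=
  RModHom (@bar_d_additive n) (@bar_d_act n).

Definition bar_aug (z : bar_module 0) : int := freeg_lift (fun=> 1 : int) z.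

Lemma bar_aug_additive : zmod_morphism bar_aug.
Proof. exact: freeg_lift_additive. Qed.

Lemma bar_augU t : bar_aug << t >> = 1.
Proof. exact: freeg_liftU. Qed.

Lemma bar_aug_act g (x : bar_module 0) : bar_aug (ract x g) = bar_aug x.
Proof.
move: x; apply: bar_ext => [||t]; last by rewrite bar_ractU !bar_augU.
- exact: zmod_morphism_comp bar_aug_additive (ract_additive g).
- exact: bar_aug_additive.
Qed.

Definition bar_base : bar_module 0 := << [ffun=> 1%g] >>.

Lemma bar_aug_surj k : exists x, bar_aug x = k.
Proof.
exists (bar_base *~ k); rewrite (zmod_morphismMz bar_aug_additive) bar_augU.
by rewrite intz.
Qed.

(* coning off from the neutral element, a non-equivariant contraction *)
Definition bar_contract n (z : bar_module n) : bar_module n.+1 := freeg_map (@bar_cone n) z.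

Lemma bar_contract_additive n : zmod_morphism (@bar_contract n).
Proof. exact: freeg_map_additive. Qed.

Lemma bar_contract0 (z : bar_module 0) :
  bar_d 0 (bar_contract z) = z - bar_base *~ bar_aug z.
Proof.
move: z; apply: bar_ext => [x y|x y|t].
- by rewrite bar_contract_additive rmh_additive.
- by rewrite bar_aug_additive mulrzBr opprD addrACA -opprD.
rewrite /bar_contract freeg_mapU [LHS]bar_dU bar_augU !big_ord_recl big_ord0.
rewrite bar_face0_cone addr0 /bump /= expr1 mulrNz !mulr1z; congr (_ - << _ >>).
by apply/ffunP => i; rewrite !ord1 !ffunE coface_ord0 unlift_none.
Qed.

Lemma bar_contractS n (z : bar_module n.+1) :
  bar_d n.+1 (bar_contract z) = z - bar_contract (bar_d n z).
Proof.
move: z; apply: bar_ext => [x y|x y|t].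
- by rewrite bar_contract_additive rmh_additive.
- by rewrite rmh_additive bar_contract_additive opprD addrACA -opprD.
rewrite /bar_contract freeg_mapU [LHS]bar_dU [bar_d n _]bar_dU big_ord_recl.
rewrite bar_face0_cone mulr1z raddf_sum -sumrN; congr (_ + _).
apply: eq_bigr => i _; rewrite raddfMz /= freeg_mapU bar_faceS_cone.
by rewrite /bump /= add1n exprS mulN1r mulrNz.
Qed.

Lemma bar_aug_d (z : bar_module 1) : bar_aug (bar_d 0 z) = 0.
Proof.
move: z; apply: bar_ext => [||t].
- exact: zmod_morphism_comp bar_aug_additive (rmh_additive _).
- by move=> *; rewrite subr0.
rewrite [bar_d 0 _]bar_dU (zmod_morphism_sum bar_aug_additive) !big_ord_recl big_ord0.
by rewrite !(zmod_morphismMz bar_aug_additive) !bar_augU.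
Qed.

(* Every tuple is a translate of a cone, and on cones the contraction reduces
   the claim to lower degree. *)
Lemma bar_dd n (z : bar_module n.+2) : bar_d n (bar_d n.+1 z) = 0.
Proof.
elim: n z => [|n IH]; apply: bar_ext.
- exact: zmod_morphism_comp (rmh_additive _) (rmh_additive _).
- by move=> *; rewrite subr0.
- move=> t; rewrite [t]bar_tuple_cone -bar_ractU -freeg_mapU 2!rmh_act.
  rewrite bar_contractS rmh_additive bar_contract0 bar_aug_d mulr0z subr0 subrr.
  exact: zmod_morphism0 (ract_additive _).
- exact: zmod_morphism_comp (rmh_additive _) (rmh_additive _).
- by move=> *; rewrite subr0.
- move=> t; rewrite [t]bar_tuple_cone -bar_ractU -freeg_mapU 2!rmh_act.
  rewrite bar_contractS rmh_additive bar_contractS IH.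
  rewrite (zmod_morphism0 (@bar_contract_additive _)) subr0 subrr.
  exact: zmod_morphism0 (ract_additive _).
Qed.

Lemma bar_exact0 (x : bar_module 0) : bar_aug x = 0 <-> exists y, bar_d 0 y = x.
Proof.
split=> [x0|[y <-]]; last exact: bar_aug_d.
by exists (bar_contract x); rewrite bar_contract0 x0 mulr0z subr0.
Qed.

Lemma bar_exact n (x : bar_module n.+1) :
  bar_d n x = 0 <-> exists y, bar_d n.+1 y = x.
Proof.
split=> [x0|[y <-]]; last exact: bar_dd.
exists (bar_contract x); rewrite bar_contractS x0.
by rewrite (zmod_morphism0 (@bar_contract_additive _)) subr0.
Qed.

(** The action on tuples is free, with the tuples of first entry 1 as orbit representatives. A
    preimage is chosen for each representative [bar_tact (t ord0) t] and translated along its orbit,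
    which makes the lift equivariant. *)
Lemma bar_projective n : projective (bar_module n).
Proof.
move=> M N q f /choice[sec secE].
pose h0 (t : bar_tuple n) : M := ract (sec (f << bar_tact (t ord0) t >>)) (t ord0)^-1%g.
pose h (x : bar_module n) : M := freeg_lift h0 x.
have hB : zmod_morphism h by apply: freeg_lift_additive.
have hU t : h << t >> = h0 t by apply: freeg_liftU.
have hG g (x : bar_module n) : h (ract x g) = ract (h x) g.
  move: x; apply: bar_ext => [||t].
  - by move=> x y; rewrite ract_additive hB.
  - by move=> x y; rewrite hB ract_additive.
  rewrite bar_ractU !hU /h0 -ractM ffunE invgM invgK.
  by rewrite -bar_tactM mulVKg.
exists (RModHom hB hG).
apply: bar_ext => [||t] /=.
- exact: zmod_morphism_comp (rmh_additive q) hB.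
- by move=> x y; rewrite rmh_additive.
by rewrite hU rmh_act secE -rmh_act bar_ractU -bar_tactM mulgV bar_tact1.
Qed.

Definition bar_resolution : projective_resolution Gamma :=
  ProjectiveResolution bar_projective bar_aug_additive bar_aug_act bar_aug_surj
    bar_exact0 bar_exact.
End BarResolution.

(** * Orbit chains *)

Lemma is_subgroupMz (M : zmodType) (H : set M) : is_subgroup H ->
  forall x (k : int), H x -> H (x *~ k).
Proof.
move=> [H0 HB] x k Hx.
have HN y : H y -> H (- y) by move=> Hy; rewrite -sub0r; apply: HB.
have HMn n : H (x *+ n).
  elim: n => [|n IH]; first by rewrite mulr0n.
  by rewrite mulrSr -[x in _ + x]opprK; apply: HB => //; apply: HN.
by case: k => n; [exact: HMn|rewrite NegzE mulrNz; apply/HN/HMn].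
Qed.

Lemma freeg_sub_ind (S : choiceType) (M : zmodType) (f : {freeg S} -> M) (H : set M) :
  zmod_morphism f -> is_subgroup H -> (forall s, H (f << s >>)) -> forall x, H (f x).
Proof.
move=> fB HH Hs; apply: freeg_ind_dom0 => [|k s x _ _ IH].
  by rewrite zmod_morphism0 //; case: HH.
have -> : << k *g s >> = << s >> *~ k :> {freeg S}.
  by rewrite freegU_mulz intz.
rewrite (zmod_morphismD fB) (zmod_morphismMz fB) -[f x]opprK.
have [H0 HB] := HH; apply: (HB); first exact: is_subgroupMz.
by rewrite -sub0r; apply: HB.
Qed.

Section TensorLift.
Variables (Gamma : groupType) (P : rmod Gamma) (V : gmod Gamma) (M : zmodType).
Variable b : P -> V -> M.
Hypotheses (bBl : forall v, zmod_morphism (b^~ v)) (bBr : forall p, zmod_morphism (b p)).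
Hypothesis b_act : forall g p v, b (ract p g) v = b p (lact g v).

Let bpair (z : {freeg (P * V)}) : M := freeg_lift (fun pv => b pv.1 pv.2) z.

Lemma bpairB : zmod_morphism bpair. Proof. exact: freeg_lift_additive. Qed.

Lemma bpairU p v : bpair << (p, v) >> = b p v. Proof. exact: freeg_liftU. Qed.

Lemma bpair_relations z : z \in @tensor_relations _ P V -> bpair z = 0.
Proof.
move=> /asboolP; move: z; apply: smallest_sub.
  split=> [|x y /= hx hy]; first exact: zmod_morphism0 bpairB.
  by rewrite bpairB hx hy subrr.
move=> z [[x [y [v ->]]]|[[x [v [w ->]]]|[a [x [v ->]]]]] /=;
  rewrite !bpairB !bpairU.
- by rewrite (zmod_morphismD (bBl v)) addrAC addrK subrr.
- by rewrite (zmod_morphismD (bBr x)) addrAC addrK subrr.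
- by rewrite b_act subrr.
Qed.

(** [repr] is an arbitrary choice of representative, with no additivity of its own;
    [bpair_relations] is what makes the result independent of it. *)
Definition tensor_lift (q : tensor_group P V) : M := bpair (repr q).

Lemma tensor_lift_pi z : tensor_lift (tensor_pi z) = bpair z.
Proof.
by apply/eqP; rewrite -subr_eq0 -bpairB bpair_relations //; apply: repr_tensor_pi.
Qed.

Lemma tensor_lift_additive : zmod_morphism tensor_lift.
Proof.
move=> x y; rewrite -[x]tensor_pi_repr -[y]tensor_pi_repr -tensor_pi_additive.
by rewrite !tensor_lift_pi bpairB.
Qed.

Lemma tensor_liftU p v : tensor_lift (tensor_pi << (p, v) >>) = b p v.
Proof. by rewrite tensor_lift_pi bpairU. Qed.
End TensorLift.

Section OrbitChain.
Variable Gamma : groupType.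
Implicit Types S T : gset Gamma.

Definition coarse_space S : bcs Gamma := tensor (can_min Gamma) (min_max S).

Definition coarse_tuple S n (g : Gamma) (t : bar_tuple Gamma n) (s : S) :
    {ffun 'I_n.+1 -> coarse_space S} :=
  [ffun i => ((g * t i)%g, gact g s)].

Definition orbit_fun S n (t : bar_tuple Gamma n) (s : S)
    (x : {ffun 'I_n.+1 -> coarse_space S}) : int :=
  if `[< exists g, x = coarse_tuple g t s >] then 1 else 0.

Lemma orbit_funE S n (t : bar_tuple Gamma n) (s : S) g :
  orbit_fun t s (coarse_tuple g t s) = 1.
Proof. by rewrite /orbit_fun asboolT //; exists g. Qed.

Lemma orbit_fun_neq0 S n (t : bar_tuple Gamma n) (s : S) x :
  orbit_fun t s x != 0 -> exists g, x = coarse_tuple g t s.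
Proof. by rewrite /orbit_fun; case: ifP => [/asboolP|]. Qed.

Lemma coarse_tuple_act S n g h (t : bar_tuple Gamma n) (s : S) :
  [ffun i => gact g (coarse_tuple h t s i)] = coarse_tuple (g * h)%g t s.
Proof. by apply/ffunP => i; rewrite !ffunE /= mulgA gactM. Qed.

Lemma finite_range_ord n (T : choiceType) (f : 'I_n -> T) : finite_set (range f).
Proof. exact/finite_image/finite_finset. Qed.

Lemma orbit_mem S n (t : bar_tuple Gamma n) (s : S) :
  orbit_fun t s \in @coarse_chain_pred _ (coarse_space S) n.
Proof.
apply/asboolP; split.
- exists (rel_prod (X := can_min Gamma) (Y := min_max S) (can_generator (range t)) diag).
    apply: tensor_ent_prod; last by case: (min_coarse S).
    by apply: sub_gen_smallest; exists (range t) => //; apply: finite_range_ord.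
  move=> x /orbit_fun_neq0[g ->] i j; rewrite !ffunE; split=> //=.
  by exists g, (t i), (t j); split=> //; exists i.
- move=> W /tensor_bdd_sub[B [B' [fB _ WB]]].
  (* A translate meeting the bounded set has an entry g t_i in the finite set [B], and g is
     recovered from that entry and [i]. So finitely many pairs account for all such translates. *)
  pose h (q : Gamma * 'I_n.+1) := coarse_tuple (q.1 * (t q.2)^-1)%g t s.
  have fBI : finite_set (B `*` [set: 'I_n.+1] : set (Gamma * 'I_n.+1)).
    by apply: finite_setX => //; exact: finite_finset.
  apply: sub_finite_set (finite_image h fBI).
  move=> x [/orbit_fun_neq0[g ->] [i /WB[/= Bi _]]].
  by exists ((g * t i)%g, i); rewrite /h /= ?mulgK //; split=> //; move: Bi; rewrite ffunE.
- move=> g x; rewrite /orbit_fun; congr (if _ then _ else _); apply: asbool_equiv_eq.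
  split=> [[h hE]|[h ->]]; last by exists (g * h)%g; rewrite coarse_tuple_act.
  exists (g^-1 * h)%g; rewrite -coarse_tuple_act -hE.
  by apply/ffunP => i; rewrite !ffunE gactK.
Qed.

Definition orbit_chain S n (t : bar_tuple Gamma n) (s : S) : chain (coarse_space S) n :=
  Chain (orbit_mem t s).

(** Translation by g carries (g^-1 t, s) to (t, g s), so both lie in one orbit. This is the
    balancing relation of the tensor product over the group ring. *)
Lemma orbit_chain_act S n (t : bar_tuple Gamma n) (s : S) g :
  orbit_chain (bar_tact g t) s = orbit_chain t (gact g s).
Proof.
have E h : coarse_tuple h (bar_tact g t) s = coarse_tuple (h * g^-1)%g t (gact g s).
  by apply/ffunP => i; rewrite !ffunE mulgA -gactM mulgVK.
apply: chain_eq => x /=; rewrite /orbit_fun; congr (if _ then _ else _).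
apply: asbool_equiv_eq; split=> [[h ->]|[h ->]]; first by exists (h * g^-1)%g.
by exists (h * g)%g; rewrite E mulgK.
Qed.

(** No multiplicities arise, even if [f0] or [r] identifies points: a tuple of the target orbit
    determines g from its first group entry, hence has exactly one preimage in the source orbit. The
    case of a coface with the identity gives the boundary, and the case [r = id] gives functoriality
    in S. *)
Lemma push_orbit_chain S T (f : bcs_hom (coarse_space S) (coarse_space T))
    (f0 : gset_hom S T) n m (r : 'I_m.+1 -> 'I_n.+1) (t : bar_tuple Gamma n) (s : S) :
  (forall p, f p = (p.1, f0 p.2)) ->
  push_chain f r (orbit_chain t s) = orbit_chain [ffun i => t (r i)] (f0 s).
Proof.
move=> fE; set t' := [ffun i => t (r i)].
have rE g : reindex_tuple f r (coarse_tuple g t s) = coarse_tuple g t' (f0 s).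
  by apply/ffunP => i; rewrite !ffunE fE /= gsh_act.
have tI g h : coarse_tuple g t' (f0 s) = coarse_tuple h t' (f0 s) -> g = h.
  by move=> /ffunP/(_ ord0); rewrite !ffunE => -[/mulIg].
apply: chain_eq => y /=.
have [[g yE]|ny] := pselect (exists g, y = coarse_tuple g t' (f0 s)).
  rewrite yE orbit_funE (pushE (r := [:: coarse_tuple g t s])) //.
    by rewrite big_cons big_nil rE eqxx addr0 orbit_funE.
  by move=> x /orbit_fun_neq0[h ->]; rewrite rE => /tI ->; rewrite mem_head.
rewrite /orbit_fun asboolF //; apply/eqP; apply: contra_notT ny.
by move=> /push_supp[x <- /orbit_fun_neq0[g ->]]; exists g; rewrite rE.
Qed.
End OrbitChain.

(** * The isomorphism from the tensored bar resolution to coarse chains *)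

Section BarTensorChains.
Variables (Gamma : groupType) (S : gset Gamma).
Local Notation V := (perm_gmod S).
Local Notation Q := (bar_resolution Gamma).

Definition bar_pair n (p : bar_module Gamma n) (v : V) : chain (coarse_space S) n :=
  freeg_lift (fun t => freeg_lift (fun s => orbit_chain t s) v) p.

Lemma bar_pairBl n v : zmod_morphism (fun p => @bar_pair n p v).
Proof. exact: freeg_lift_additive. Qed.

Lemma bar_pairBr n p : zmod_morphism (@bar_pair n p).
Proof.
move=> v w; move: p; apply: bar_ext => [||t].
- exact: bar_pairBl.
- by move=> x y; rewrite !bar_pairBl opprD addrACA -opprD.
by rewrite /bar_pair !freeg_liftU freeg_lift_additive.
Qed.

Lemma bar_pairU n t s : @bar_pair n << t >> << s >> = orbit_chain t s.
Proof. by rewrite /bar_pair !freeg_liftU. Qed.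

Lemma bar_pair_act n g p v : @bar_pair n (ract p g) v = bar_pair p (lact g v).
Proof.
move: p; apply: bar_ext => [||t].
- exact: zmod_morphism_comp (bar_pairBl v) (ract_additive g).
- exact: bar_pairBl.
rewrite bar_ractU; move: v; apply: (@freeg_ext S).
- exact: bar_pairBr.
- exact: zmod_morphism_comp (@bar_pairBr _ _) (@lact_additive _ V g).
by move=> s; rewrite /= freeg_mapU !bar_pairU orbit_chain_act.
Qed.

Definition bar_to_chain n : derived_tensor Q V n -> coarse_complex (coarse_space S) n :=
  tensor_lift (@bar_pair n).

Lemma bar_to_chain_additive n : zmod_morphism (@bar_to_chain n).
Proof.
apply: tensor_lift_additive; [exact: bar_pairBl|exact: bar_pairBr|exact: bar_pair_act].
Qed.

Lemma bar_to_chain_tensor n p v :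
  @bar_to_chain n (tensor_pi << (p, v) >>) = bar_pair p v.
Proof.
apply: tensor_liftU; [exact: bar_pairBl|exact: bar_pairBr|exact: bar_pair_act].
Qed.

Definition basis_tensor n (t : bar_tuple Gamma n) (s : S) : derived_tensor Q V n :=
  tensor_pi << ((<< t >> : bar_module Gamma n), (<< s >> : V)) >>.

(** Generation in three layers: elementary tensors generate the quotient, and each of their two
    factors is generated by its own basis. *)
Lemma bar_tensor_ind n (H : set (derived_tensor Q V n)) : is_subgroup H ->
  (forall t s, H (basis_tensor t s)) -> forall q, H q.
Proof.
move=> HH Hb q; rewrite -[q]tensor_pi_repr.
apply: (@freeg_sub_ind _ _ (@tensor_pi _ (bar_module Gamma n) V)) => //.
  exact: tensor_pi_additive.
move=> [p v].
apply: (@freeg_sub_ind _ _ (fun p : bar_module Gamma n => tensor_pi << (p, v) >>)) => //.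
  by move=> x y; rewrite tensor_piBl.
move=> t.
apply: (@freeg_sub_ind S _
  (fun v : V => tensor_pi << ((<< t >> : bar_module Gamma n), v) >>)) => // [x y|s].
  by rewrite (@tensor_piBr _ V).
exact: Hb.
Qed.

Lemma bar_tensor_ext n (M : zmodType) (a b : derived_tensor Q V n -> M) :
  zmod_morphism a -> zmod_morphism b ->
  (forall t s, a (basis_tensor t s) = b (basis_tensor t s)) ->
  forall q, a q = b q.
Proof.
move=> aB bB ab; apply: bar_tensor_ind => //; split=> [|x y /= xE yE].
  by rewrite /= (zmod_morphism0 aB) (zmod_morphism0 bB).
by rewrite aB bB xE yE.
Qed.

Lemma bar_to_chain_bd n (q : derived_tensor Q V n.+1) :
  bar_to_chain (bd q) = bd (bar_to_chain q).
Proof.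
apply: (@bar_tensor_ext n.+1 _ (fun q => bar_to_chain (tensor_bd (P := Q) q))
  (fun q => coarse_bd (bar_to_chain q))).
- by move=> x y; rewrite /tensor_bd tensor_group_map_additive bar_to_chain_additive.
- by move=> x y; rewrite bar_to_chain_additive coarse_bd_additive.
move=> t s; rewrite /basis_tensor /tensor_bd tensor_group_mapU !bar_to_chain_tensor bar_pairU /=.
rewrite bar_dU (zmod_morphism_sum (@bar_pairBl n _)); apply: eq_bigr => i _.
rewrite (zmod_morphismMz (@bar_pairBl n _)) bar_pairU.
by rewrite (@push_orbit_chain _ _ _ _ (gset_id S)) //; case.
Qed.

Definition bar_chain_map :
    nat_chain_map (derived_tensor Q V) (coarse_complex (coarse_space S)) :=
  NatChainMap bar_to_chain_additive bar_to_chain_bd.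

Definition bar_normal n (t : bar_tuple Gamma n) : bar_tuple Gamma n := bar_tact (t ord0) t.

(** An orbit has only one tuple with first group entry 1, since the first entry fixes the
    translating element. Evaluations at such tuples are therefore dual to the normalized orbit
    chains. *)
Lemma orbit_chain_normal n (t t' : bar_tuple Gamma n) (s s' : S) :
  t ord0 = 1%g -> t' ord0 = 1%g ->
  orbit_chain t s (coarse_tuple 1%g t' s') = ((t, s) == (t', s'))%:Z.
Proof.
move=> t1 t1'; rewrite /= /orbit_fun.
have [[-> ->]|ne] := eqVneq (t, s) (t', s').
  by rewrite asboolT //; exists 1%g.
rewrite asboolF // => -[g] /ffunP E; case/eqP: ne.
have g1 : g = 1%g.
  by have := E ord0; rewrite !ffunE t1 t1' !mulg1 => -[].
congr (_, _); last by have := E ord0; rewrite !ffunE g1 !gact1 => -[].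
by apply/ffunP => i; have := E i; rewrite !ffunE g1 !mul1g => -[].
Qed.

Lemma bar_normal0 n (t : bar_tuple Gamma n) : bar_normal t ord0 = 1%g.
Proof. by rewrite ffunE mulVg. Qed.

Lemma basis_tensor_normal n (t : bar_tuple Gamma n) (s : S) :
  basis_tensor t s = basis_tensor (bar_normal t) (gact (t ord0)^-1%g s).
Proof.
rewrite /basis_tensor.
have -> : << gact (t ord0)^-1%g s >> = lact (t ord0)^-1%g (<< s >> : V).
  by rewrite /= freeg_mapU.
by rewrite -(tensor_pi_ract (<< bar_normal t >> : bar_module Gamma n)) bar_ractU
  -bar_tactM mulgV bar_tact1.
Qed.

(* The basis tensors with first vertex 1 turn out to be a basis of the
   tensor product. *)
Definition normal_pair n := {ts : bar_tuple Gamma n * S | ts.1 ord0 == 1%g}.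

Definition normal_span n (u : {freeg (normal_pair n)}) : derived_tensor Q V n :=
  freeg_lift (fun x : normal_pair n => basis_tensor (sval x).1 (sval x).2) u.

Lemma normal_span_additive n : zmod_morphism (@normal_span n).
Proof. exact: freeg_lift_additive. Qed.

Lemma normal_span_surj n (q : derived_tensor Q V n) : exists u, normal_span u = q.
Proof.
apply: (@bar_tensor_ind n [set q | exists u, normal_span u = q]).
  split=> [|_ _ [u <-] [v <-]].
    by exists 0; apply: zmod_morphism0; apply: normal_span_additive.
  by exists (u - v); rewrite normal_span_additive.
move=> t s.
have x1 : (bar_normal t, gact (t ord0)^-1%g s).1 ord0 == 1%g by rewrite bar_normal0.
exists << (exist (fun ts : bar_tuple Gamma n * S => ts.1 ord0 == 1%g) _ x1) >>.
by rewrite /normal_span freeg_liftU -basis_tensor_normal.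
Qed.

(** The coefficients can be read off from the resulting chain. Injectivity thus follows from
    spanning alone, and the independence of the normalized tensors comes as a by-product. *)
Lemma normal_span_coeff n (u : {freeg (normal_pair n)}) (x : normal_pair n) :
  bar_to_chain (normal_span u) (coarse_tuple 1%g (sval x).1 (sval x).2) = coeff x u.
Proof.
move: u; apply: freeg_ext => [u v|u v|y].
- by rewrite normal_span_additive bar_to_chain_additive chain_subE.
- exact: coeffB.
rewrite /normal_span freeg_liftU bar_to_chain_tensor bar_pairU coeffU mul1r.
rewrite orbit_chain_normal; [|exact/eqP/(svalP y)|exact/eqP/(svalP x)].
by rewrite -!surjective_pairing -val_eqE; case: eqP.
Qed.

Lemma bar_to_chain_inj n : injective (@bar_to_chain n).
Proof.
move=> q q' qq'; apply/eqP; rewrite -subr_eq0; apply/eqP.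
have [u uE] := normal_span_surj (q - q').
suff u0 : u = 0 by rewrite -uE u0 zmod_morphism0 //; apply: normal_span_additive.
apply/eqP/freeg_eqP => x; rewrite -normal_span_coeff uE bar_to_chain_additive qq' subrr.
by rewrite coeff0.
Qed.

Lemma coarse_chain_tuple n (c : chain (coarse_space S) n) x : c x != 0 ->
  exists t s, x = coarse_tuple 1%g t s.
Proof.
have [[U /tensor_ent_sub[A [B [_ /min_diag BD UAB]]] cU] _ _] := chainP c.
move=> /cU cx; exists [ffun i => (x i).1], (x ord0).2.
apply/ffunP => i; rewrite !ffunE mul1g gact1.
have /UAB[_ /BD xi] := cx i ord0.
by rewrite [LHS]surjective_pairing; congr (_, _).
Qed.

Lemma bar_to_chain_surj n (c : chain (coarse_space S) n) : exists q, bar_to_chain q = c.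
Proof.
have [_ cf ci] := chainP c.
(* Every subset of S is bounded, hence so is {1} x S, and local finiteness applies to it. The
   resulting list [r] has one tuple for each orbit in the support. *)
have /finite_seqP[r rE] : finite_set [set x | c x != 0 /\ (x ord0).1 = 1%g].
  have hB : @bounded _ (coarse_space S) ([set 1%g] `*` setT).
    by apply: tensor_bdd_prod => //; apply: finite_set1.
  by apply: sub_finite_set (cf _ hB) => x [cx x1]; split=> //; exists ord0.
pose b (x : {ffun 'I_n.+1 -> coarse_space S}) :=
  basis_tensor [ffun i => (x i).1] (x ord0).2.
exists (\sum_(x <- undup r) b x *~ c x); apply: chain_eq => y.
have evB : zmod_morphism (fun q : derived_tensor Q V n => bar_to_chain q y).
  by move=> q q'; rewrite bar_to_chain_additive.
rewrite (zmod_morphism_sum evB).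
(* The member of the orbit of [y] with first group entry 1: at [y] only its summand can be nonzero,
   and invariance gives c z = c y. *)
pose z : {ffun 'I_n.+1 -> coarse_space S} := [ffun i => gact ((y ord0).1)^-1%g (y i)].
have bE x : x \in undup r -> bar_to_chain (b x *~ c x) y = c x *+ (x == z).
  rewrite mem_undup => xr.
  have [cx x1] : [set x | c x != 0 /\ (x ord0).1 = 1%g] x by rewrite rE.
  have [t [s xE]] := coarse_chain_tuple cx.
  have t1 : t ord0 = 1%g by move: x1; rewrite xE ffunE /= mul1g.
  have -> : b x = basis_tensor t s.
    rewrite /b xE ffunE /= gact1; congr basis_tensor.
    by apply/ffunP => i; rewrite !ffunE mul1g.
  rewrite (zmod_morphismMz evB) bar_to_chain_tensor bar_pairU.
  have [xz|/eqP xz] := eqVneq x z.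
    have -> : y = coarse_tuple (y ord0).1 t s.
      rewrite -[(y ord0).1]mulg1 -coarse_tuple_act -xE xz.
      by apply/ffunP => i; rewrite !ffunE gactVK.
    by rewrite [orbit_chain _ _ _]orbit_funE intz.
  suff -> : orbit_chain t s y = 0 by rewrite mul0rz.
  apply/eqP; apply: contra_notT xz => /orbit_fun_neq0[h yE].
  rewrite xE /z yE; apply/ffunP => i.
  by rewrite !ffunE /= t1 mulg1 -gactM mulKg mulVg mul1g.
have <- : c z = c y by apply: ci.
rewrite (eq_big_seq _ bE).
have [zr|zr] := boolP (z \in undup r).
  rewrite (bigD1_seq z) ?undup_uniq //= eqxx mulr1n big1 ?addr0 // => x /negPf ->.
  by rewrite mulr0n.
rewrite big1_seq => [|x /= xr]; last first.
  by case: eqP => [xz|]; rewrite ?mulr0n // -xz xr in zr.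
apply/esym/eqP; apply: contraNT zr => cz; rewrite mem_undup.
have : [set x | c x != 0 /\ (x ord0).1 = 1%g] z.
  by split=> //; rewrite ffunE /= mulVg.
by rewrite rE.
Qed.


Lemma bar_to_chain_bij n : bijective (@bar_to_chain n).
Proof.
have [g gK] := choice (@bar_to_chain_surj n).
by exists g => // q; apply: bar_to_chain_inj; apply: gK.
Qed.
End BarTensorChains.

(** * Naturality in S and the final equivalence *)

Lemma bar_chain_natural (Gamma : groupType) (S T : gset Gamma) (f : gset_hom S T) n
    (q : derived_tensor (bar_resolution Gamma) (perm_gmod S) n) :
  bar_to_chain (derived_tensor_fun (perm_map f) q) =
  push_chain (tensor_map (can_min Gamma) (min_max_map f)) id (bar_to_chain q).
Proof.
move: q; apply: bar_tensor_ext => [x y|x y|t s].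
- by rewrite derived_tensor_additive bar_to_chain_additive.
- by rewrite bar_to_chain_additive push_chain_additive.
rewrite /derived_tensor_fun /basis_tensor tensor_group_mapU !bar_to_chain_tensor.
rewrite /= freeg_mapU !bar_pairU (@push_orbit_chain _ _ _ _ f) //.
by congr orbit_chain; apply/ffunP => i; rewrite ffunE.
Qed.

(** The degreewise inverse of [b] is again a chain map, and conjugation by [b] carries the homotopy
    on [D] to one on [E]. *)
Lemma stable_equivalence_comp_bij (C D E : nat_complex) (f : nat_chain_map C D)
    (g : nat_chain_map D C) (b : nat_chain_map D E) :
  homotopic_to_id (nat_chain_comp g f) -> homotopic_to_id (nat_chain_comp f g) ->
  (forall n, bijective (b n)) ->
  stable_equivalence (em_map (ext_map (nat_chain_comp b f))).
Proof.
move=> gf fg b_bij.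
have inv n : exists g, cancel (b n) g /\ cancel g (b n).
  by have [g' ? ?] := b_bij n; exists g'.
pose b' n := sval (cid (inv n)).
have bK n : cancel (b n) (b' n) := (svalP (cid (inv n))).1.
have b'K n : cancel (b' n) (b n) := (svalP (cid (inv n))).2.
have b'B n : zmod_morphism (b' n).
  by move=> x y; apply: (can_inj (bK n)); rewrite nchm_additive !b'K.
have b'bd n (x : E n.+1) : b' n (bd x) = bd (b' n.+1 x).
  by apply: (can_inj (bK n)); rewrite nchm_bd !b'K.
apply: (@em_ext_stable_equivalence _ _ _ (nat_chain_comp g (NatChainMap b'B b'bd))).
  have -> : nat_chain_comp (nat_chain_comp g (NatChainMap b'B b'bd)) (nat_chain_comp b f) =
      nat_chain_comp g f by apply: nat_chain_map_eq => n x; rewrite /= bK.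
  exact: gf.
have [h [hB h0 hS]] := fg.
exists (fun n x => b n.+1 (h n (b' n x))); split=> [n|x|n x] /=.
- by move=> x y; rewrite b'B hB nchm_additive.
- by rewrite -{2}[x]b'K -nchm_additive [X in b 0%N X]h0 nchm_bd.
- rewrite -{2}[x]b'K -nchm_additive [X in b n.+1 X]hS.
  by rewrite (zmod_morphismD (@nchm_additive _ _ b n.+1)) nchm_bd b'bd.
Qed.

Lemma em_ext_comp (C D E : nat_complex) (g : nat_chain_map D E) (f : nat_chain_map C D) :
  spectrum_comp (em_map (ext_map g)) (em_map (ext_map f)) =
  em_map (ext_map (nat_chain_comp g f)).
Proof. by rewrite -ext_map_comp; apply: spectrum_hom_eq => n p x; apply: em_simplex_eq. Qed.

Lemma em_ext_square (A B C D : nat_complex) (f : nat_chain_map A B)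
    (g : nat_chain_map B D) (h : nat_chain_map A C) (k : nat_chain_map C D) :
  nat_chain_comp g f = nat_chain_comp k h ->
  spectrum_comp (em_map (ext_map g)) (em_map (ext_map f)) =
  spectrum_comp (em_map (ext_map k)) (em_map (ext_map h)).
Proof. by move=> E; rewrite !em_ext_comp E. Qed.

Theorem proposition7p5 (Gamma : groupType) (P : projective_resolution Gamma) :
  equivalent_functors
    (CoarseHomology Gamma \of (TensorLeft (can_min Gamma) \of MinMax Gamma))
    (GroupHomology P \of PermutationModule Gamma).
Proof.
have [f] := comparison_exists P (bar_resolution Gamma).
have [g] := comparison_exists (bar_resolution Gamma) P.
pose theta (S : gset Gamma) :=
  nat_chain_comp (bar_chain_map S) (derived_change (perm_gmod S) f).
have thetaN (S T : gset Gamma) (a : gset_hom S T) :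
    nat_chain_comp (theta T) (derived_tensor_map P (perm_map a)) =
    nat_chain_comp (coarse_map (tensor_map (can_min Gamma) (min_max_map a))) (theta S).
  apply: nat_chain_map_eq => n x.
  apply: etrans (bar_chain_natural a (derived_change_fun f x)).
  exact: (congr1 (@bar_to_chain _ T n) (derived_change_natural f (perm_map a) x)).
(* The zigzag is a single arrow that starts at group homology, since the orbit map is defined on
   elementary tensors; hence the reversal. *)
apply: rst_sym; apply: rst_step.
have theta_nat (S T : GSets Gamma) (a : Hom S T) :
    @comp Spectra _ _ _ (em_map (ext_map (theta T)))
      (fmap (GroupHomology P \of PermutationModule Gamma) a) =
    @comp Spectra _ _ _
      (fmap (CoarseHomology Gamma \of (TensorLeft (can_min Gamma) \of MinMax Gamma)) a)
      (em_map (ext_map (theta S))).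
  exact: em_ext_square (thetaN S T a).
exists (@NatTrans _ Spectra (GroupHomology P \of PermutationModule Gamma)
  (CoarseHomology Gamma \of (TensorLeft (can_min Gamma) \of MinMax Gamma))
  (fun S => em_map (ext_map (theta S))) theta_nat) => S.
apply: (@stable_equivalence_comp_bij _ _ _ _ (derived_change (perm_gmod S) g)).
- exact: derived_change_homotopic.
- exact: derived_change_homotopic.
- exact: bar_to_chain_bij.
Qed.
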